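(* Let $(\Omega,\mathcal F,\mathbb P)$ be a non-atomic probability space, let $\Sigma$ be the collection of all sub-$\sigma$-algebras of $\mathcal F$, and let $\{\mathcal E_{\mathcal G}\}_{\mathcal G\in\Sigma}$ be a family of maps $\mathcal E_{\mathcal G}:L^\infty(\Omega,\mathcal F,\mathbb P)\to L^\infty(\Omega,\mathcal G,\mathbb P)$. Then the following are equivalent: (a) $\{\mathcal E_{\mathcal G}\}_{\mathcal G\in\Sigma}$ is a time consistent family of conditional nonlinear expectations and $\mathcal E_0$ is strictly monotone on dichotomic random variables and pointwise continuous (both notions as defined in the context); (b) there exists a function $\mathbb u:\Omega\times\mathbb R\to\mathbb R$ which is $\mathcal F$-regular and such that $\mathbb u(\cdot,x)$ is $\mathbb P$-integrable for every $x\in\mathbb R$, and for every $\mathcal G\in\Sigma$ there is a $\mathcal G$-regular function $\mathbb u_{\mathcal G}$ such that, for every $x\in\mathbb R$, $\mathbb u_{\mathcal G}(\cdot,x)$ is $\mathbb P$-integrable and is a version of $\mathbb E_{\mathbb P}[\mathbb u(\cdot,x)\mid\mathcal G]$, and such that for every $X\in L^\infty(\Omega,\mathcal F,\mathbb P)$ $$\mathcal E_{\mathcal G}(X)=\mathbb u_{\mathcal G}^{-1}\big(\mathbb E_{\mathbb P}[\mathbb u(X)\mid \mathcal G]\big).$$ Here $\mathbb u_{\mathcal G}^{-1}(\mathbb E_{\mathbb P}[\mathbb u(X)\mid\mathcal G])$ denotes the $\mathbb P$-equivalence class of $\omega\mapsto\Phi_{\mathcal G}(\omega,h(\omega))$,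 where $f$ is any representative of $X$, $h$ is a version of $\mathbb E_{\mathbb P}[\mathbb u(\cdot,f(\cdot))\mid\mathcal G]$ with $h(\omega)\in\{\mathbb u_{\mathcal G}(\omega,y):y\in\mathbb R\}$ for every $\omega$ (such a version exists, and the resulting class does not depend on the choices), and $\Phi_{\mathcal G}(\omega,x):=\inf\{y\in\mathbb R:\mathbb u_{\mathcal G}(\omega,y)>x\}$.
   Context: $L^\infty(\Omega,\mathcal G,\mathbb P)$ is the space of $\mathbb P$-a.s. equivalence classes of bounded $\mathcal G$-measurable real random variables. $\mathcal E_0$ denotes $\mathcal E_{\mathcal G}$ for the trivial $\sigma$-algebra $\mathcal G=\{\varnothing,\Omega\}$ (so $\mathcal E_0$ is real-valued). A map $\mathcal E_{\mathcal G}$ is a conditional nonlinear expectation if $\mathcal E_{\mathcal G}(X1_A)=\mathcal E_{\mathcal G}(X)1_A$ for all $X\in L^\infty(\Omega,\mathcal F,\mathbb P)$ and $A\in\mathcal G$. The family is time consistent if $\mathcal E_0(\mathcal E_{\mathcal G}(X))=\mathcal E_0(X)$ for all $\mathcal G\in\Sigma$ and all $X$. $\mathcal E_0$ is strictly monotone on dichotomic random variables if for all $x<y$ in $\mathbb R$, $Z\in L^\infty(\Omega,\mathcal F,\mathbb P)$ and $A\in\mathcal F$ with $\mathbb P(A)>0$: $\mathcal E_0(x1_A+Z1_{A^c})<\mathcal E_0(y1_A+Z1_{A^c})$. $\mathcal E_0$ is pointwise continuous if $\mathcal E_0(X_n)\to\mathcal E_0(X)$ for every uniformly bounded sequence $X_n$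 converging $\mathbb P$-a.s. to $X$. For a sub-$\sigma$-algebra $\mathcal G\subseteq\mathcal F$, a function $\varphi:\Omega\times\mathbb R\to\mathbb R$ is $\mathcal G$-regular if $\varphi(\omega,\cdot)$ is continuous and strictly increasing on $\mathbb R$ for every $\omega$, $\varphi(\omega,0)=0$ for every $\omega$, and $\varphi$ is $\mathcal G\otimes\mathcal B_{\mathbb R}$-measurable. *)

(* Defs.v *)
From HB Require Import structures.
From mathcomp Require Import all_boot all_order all_algebra.
From mathcomp Require Import all_classical all_reals all_analysis.
Set Implicit Arguments. Unset Strict Implicit. Unset Printing Implicit Defensive.
Import Order.TTheory GRing.Theory Num.Theory.
Import numFieldNormedType.Exports.
Local Open Scope classical_set_scope.
Local Open Scope ring_scope.

Section defs.
Context {d : measure_display} {T : measurableType d} {R : realType}.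

Definition Fsig : set (set T) := @measurable d T.

Definition trivsig : set (set T) := [set set0; setT].

Definition sub_sigma (G : set (set T)) : Prop :=
  sigma_algebra setT G /\ G `<=` Fsig.

Definition G_meas (G : set (set T)) (f : T -> R) : Prop :=
  forall B : set R, measurable B -> G (f @^-1` B).

Definition Linf_rep (G : set (set T)) (f : T -> R) : Prop :=
  G_meas G f /\ exists M : R, forall w, `|f w| <= M.

Definition aeeq (P : probability T R) (f g : T -> R) : Prop :=
  {ae P, forall w, f w = g w}.

Definition nonatomic (P : probability T R) : Prop :=
  forall A, measurable A -> (0 < P A)%E ->
    exists B, [/\ measurable B, B `<=` A, (0 < P B)%E & (P B < P A)%E].

Definition prod_sigma (G : set (set T)) : set (set (T * R)) :=
  smallest (sigma_algebra setT)
    [set S | exists A B, [/\ G A, measurable B & S = A `*` B]].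

Definition regular (G : set (set T)) (phi : T -> R -> R) : Prop :=
  [/\ forall w, continuous (phi w),
      forall w x y, x < y -> phi w x < phi w y,
      forall w, phi w 0 = 0 &
      forall B : set R, measurable B ->
        prod_sigma G ((fun p : T * R => phi p.1 p.2) @^-1` B)].

Definition condexp_version (P : probability T R) (G : set (set T))
    (g h : T -> R) : Prop :=
  [/\ G_meas G h, P.-integrable setT (EFin \o h) &
      forall A, G A ->
        (\int[P]_(w in A) (h w)%:E = \int[P]_(w in A) (g w)%:E)%E].

Definition Phi (phi : T -> R -> R) (w : T) (x : R) : R :=
  inf [set y | x < phi w y].

(* A family of maps E_G : L^oo(F) -> L^oo(G), presented on representatives:
   sends bounded F-measurable functions to bounded G-measurable ones, and
   respects P-a.s. equality. *)
Definition Linf_family (P : probability T R)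
    (E : set (set T) -> (T -> R) -> (T -> R)) : Prop :=
  forall G, sub_sigma G ->
    (forall f, Linf_rep Fsig f -> Linf_rep G (E G f)) /\
    (forall f g, Linf_rep Fsig f -> Linf_rep Fsig g -> aeeq P f g ->
       aeeq P (E G f) (E G g)).

Definition cond_nonlin_exp (P : probability T R)
    (E : set (set T) -> (T -> R) -> (T -> R)) : Prop :=
  forall G, sub_sigma G ->
    forall f, Linf_rep Fsig f -> forall A, G A ->
      aeeq P (E G (fun w => f w * \1_A w)) (fun w => E G f w * \1_A w).

(* Time consistency: E_0(E_G(X)) = E_0(X); E_0 is real valued (constant
   functions), so we compare the values at every point. *)
Definition time_consistent (E : set (set T) -> (T -> R) -> (T -> R)) : Prop :=
  forall G, sub_sigma G -> forall f, Linf_rep Fsig f ->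
    forall w, E trivsig (E G f) w = E trivsig f w.

Definition strict_mono_dichotomic (P : probability T R)
    (E : set (set T) -> (T -> R) -> (T -> R)) : Prop :=
  forall (x y : R) (Z : T -> R) (A : set T),
    x < y -> Linf_rep Fsig Z -> measurable A -> (0 < P A)%E ->
    forall w,
      E trivsig (fun v => x * \1_A v + Z v * \1_(~` A) v) w <
      E trivsig (fun v => y * \1_A v + Z v * \1_(~` A) v) w.

Definition pointwise_continuous (P : probability T R)
    (E : set (set T) -> (T -> R) -> (T -> R)) : Prop :=
  forall (X : nat -> T -> R) (f : T -> R),
    (forall n, Linf_rep Fsig (X n)) -> Linf_rep Fsig f ->
    (exists M : R, forall n w, `|X n w| <= M) ->
    {ae P, forall w, (fun n => X n w) @ \oo --> f w} ->
    forall w, (fun n => E trivsig (X n) w) @ \oo --> E trivsig f w.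

End defs.

(* Main.v *)
(** Necessity of the representation.  Conditioning on a sigma-algebra with atom [A]
    shows that [I := E_0] satisfies Savage's sure-thing principle: the ranking of two
    functions that agree off [A] does not depend on their common part.  For constants
    [a < b] the events [S] are then ordered by [I (b 1_S + a 1_S^c)] as by a qualitative
    probability.  Non-atomicity and continuity allow every event to be halved repeatedly,
    and counting the dyadic cells below a value of [I] gives a scale [phi] such that
    [phi o I] is additive over disjoint events, on functions with values in [a, b]; such
    a scale is unique up to affine maps, so the normalised scales of growing intervals
    fit together into an additive continuous functional [V = phi o I] on all bounded
    functions.  On every sub-sigma-algebra [G] the set functions [A |-> V (x 1_A)] have
    densities; continuity of [V] along random grid points forbids jumps in [x], which
    yields a [G]-regular [u_G] with [V f = E (u_G (f))] for [G]-measurable [f].  Since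
    [V (E_G (f) 1_A) = V (f 1_A)] for [A] in [G], [u_G (E_G f)] is a version of
    [E (u (f) | G)].

    Sufficiency.  With [V f := E (u (f))] the same identity [V (E_G (f) 1_A) = V (f 1_A)]
    holds: [E_G f] is the conditional certainty equivalent of [f] under [V], and the
    properties of [E] follow from the additivity, continuity and strict monotonicity
    of [V]. *)
Require Import Defs.
From HB Require Import structures.
From mathcomp Require Import all_boot all_order all_algebra.
From mathcomp Require Import all_classical all_reals all_analysis.
From mathcomp Require Import lra ring measurable_realfun measurable_fun_approximation.
Set Implicit Arguments.
Unset Strict Implicit.
Import Order.TTheory GRing.Theory Num.Theory.
Import numFieldNormedType.Exports HBNNSimple.
Local Open Scope classical_set_scope.
Local Open Scope ring_scope.

Local Notation Linf := (Linf_rep (@Fsig _ _)).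

(** * Patched functions and sub-sigma-algebras *)

Section patch.
Context {T U : Type}.
Implicit Types (f g : T -> U) (A : set T).

Lemma patch_in g A f w : A w -> patch g A f w = f w.
Proof. by move=> Aw; rewrite patchT// inE. Qed.

Lemma patch_out g A f w : ~ A w -> patch g A f w = g w.
Proof. by move=> nAw; rewrite patchC// inE. Qed.

Lemma eq_patch A f g f' g' : (forall w, A w -> f w = f' w) ->
  (forall w, ~ A w -> g w = g' w) -> patch g A f = patch g' A f'.
Proof.
move=> ff' gg'; apply/funext => w; have [Aw|nAw] := pselect (A w).
  by rewrite !patch_in// ff'.
by rewrite !patch_out// gg'.
Qed.

Lemma patch_id A f : patch f A f = f.
Proof. by apply/funext => w; rewrite /patch; case: ifP. Qed.

Lemma patch_idr g A f : (forall w, A w -> f w = g w) -> patch g A f = g.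
Proof. by move=> fg; rewrite (eq_patch fg (fun w _ => erefl (g w))) patch_id. Qed.

Lemma patch_setC A f g : patch g (~` A) f = patch f A g.
Proof. by apply/funext => w; rewrite /patch in_setC; case: (w \in A). Qed.

Lemma patch_setU g A B f : patch g (A `|` B) f = patch (patch g B f) A f.
Proof. by apply/funext => w; rewrite /patch in_setU; case: (w \in A). Qed.

End patch.

Section patch_ring.
Context {T : Type} {R : realType}.
Implicit Types (f g : T -> R) (A : set T).

Lemma indic_patch A f g : (fun w => f w * \1_A w + g w * \1_(~` A) w) = patch g A f.
Proof.
apply/funext => w; rewrite !indicE in_setC /patch.
by case: (w \in A); rewrite /= ?mulr1 ?mulr0 ?addr0 ?add0r.
Qed.

Lemma restrictE A f : f \_ A = patch (cst 0) A f.
Proof. by []. Qed.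

Lemma indic_restrict A f : (fun w => f w * \1_A w) = f \_ A.
Proof.
rewrite restrictE -indic_patch.
by apply/funext => w; rewrite /= mul0r addr0.
Qed.

Lemma norm_patch_le (M N : R) A f g w : `|f w| <= M -> `|g w| <= N ->
  `|patch g A f w| <= Num.max M N.
Proof.
by rewrite /patch; case: ifP => _ fM gN; rewrite le_max ?fM// gN orbT.
Qed.

Lemma cvg_patch A (X Y : nat -> T -> R) f g w :
  X n w @[n --> \oo] --> f w -> Y n w @[n --> \oo] --> g w ->
  patch (Y n) A (X n) w @[n --> \oo] --> patch g A f w.
Proof. by move=> Xf Yg; rewrite /patch; case: (w \in A). Qed.

End patch_ring.

Section sub_sigma.
Context {d : measure_display} {T : measurableType d} {R : realType}.
Variable G : set (set T).
Hypothesis sG : sub_sigma G.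
Let TG := g_sigma_algebraType G.
Implicit Types (A B : set T) (f g : T -> R).

Lemma sub_sigma_measurableE : (@measurable _ TG) = G.
Proof. by apply: measurable_g_measurableTypeE; case: sG. Qed.

Lemma sub_sigma_measurable A : G A -> measurable A.
Proof. by move=> GA; exact: sG.2. Qed.

Lemma sub_sigma0 : G set0. Proof. by case: sG => -[]. Qed.

Lemma sub_sigmaC A : G A -> G (~` A).
Proof. by rewrite -sub_sigma_measurableE; exact: (@measurableC _ TG). Qed.

Lemma sub_sigmaT : G setT.
Proof. by rewrite -setC0; apply: sub_sigmaC; exact: sub_sigma0. Qed.

Lemma sub_sigmaI A B : G A -> G B -> G (A `&` B).
Proof. by rewrite -sub_sigma_measurableE; exact: (@measurableI _ TG). Qed.

Lemma sub_sigmaD A B : G A -> G B -> G (A `\` B).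
Proof. by rewrite -sub_sigma_measurableE; exact: (@measurableD _ TG). Qed.

Lemma sub_sigma_bigcup (F : (set T)^nat) : (forall n, G (F n)) -> G (\bigcup_n F n).
Proof. by rewrite -sub_sigma_measurableE; exact: (@bigcupT_measurable _ TG). Qed.

Lemma sub_sigma_exists (C : countType) (Q : C -> set T) :
  (forall c, G (Q c)) -> G [set w | exists c, Q c w].
Proof.
rewrite -sub_sigma_measurableE => mQ.
rewrite (_ : [set w | _] = \bigcup_c Q c); first exact: countable_bigcupT_measurable.
by apply/seteqP; split=> [w [c Qcw]|w [c _ Qcw]]; exists c.
Qed.

Lemma sub_sigma_forall (C : countType) (Q : C -> set T) :
  (forall c, G (Q c)) -> G [set w | forall c, Q c w].
Proof.
move=> GQ; rewrite (_ : [set w | _] = ~` [set w | exists c, (~` Q c) w]).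
  by apply/sub_sigmaC/sub_sigma_exists => c; exact: sub_sigmaC.
apply/seteqP; split=> [w Qw [c]|w /forallNP nQ c]; first by apply; exact: Qw.
exact: contrapT (nQ c).
Qed.

Lemma sub_sigma_cond (b : bool) A : G A -> G [set w | b -> A w].
Proof.
case: b => GA; last first.
  rewrite (_ : [set w | _] = setT); [exact: sub_sigmaT|by apply/seteqP; split].
by rewrite (_ : [set w | _] = A)//; apply/seteqP; split=> w //=; exact.
Qed.

Lemma G_measE f : G_meas G f <-> measurable_fun [set: TG] (f : TG -> R).
Proof.
split=> [mf _ B mB|mf B mB].
  by rewrite setTI sub_sigma_measurableE; exact: mf.
by have := mf measurableT B mB; rewrite setTI sub_sigma_measurableE.
Qed.

Lemma G_meas_measurable f : G_meas G f -> measurable_fun [set: T] f.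
Proof. by move=> mf _ B mB; rewrite setTI; apply: sub_sigma_measurable; exact: mf. Qed.

Lemma G_meas_cst c : G_meas G (cst c : T -> R).
Proof. by apply/G_measE; exact: measurable_cst. Qed.

Lemma G_meas_patch A f g : G A -> G_meas G f -> G_meas G g -> G_meas G (patch g A f).
Proof.
move=> GA /G_measE mf /G_measE mg; apply/G_measE; apply: measurable_fun_ifT => //.
apply: (measurable_fun_bool true).
by rewrite setTI preimage_mem_true sub_sigma_measurableE.
Qed.

Lemma G_measD f g : G_meas G f -> G_meas G g -> G_meas G (f \+ g).
Proof. by move=> /G_measE mf /G_measE mg; apply/G_measE; exact: measurable_funD. Qed.

Lemma G_meas_fiber f x : G_meas G f -> G [set w | f w = x].
Proof. by move=> mf; exact: (mf [set x] (measurable_set1 x)). Qed.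

Lemma G_meas_lt f g : G_meas G f -> G_meas G g -> G [set w | f w < g w].
Proof.
move=> /G_measE mf /G_measE mg.
rewrite -sub_sigma_measurableE -[X in measurable X]setTI.
exact: (measurable_fun_ltr mf mg measurableT (Y := [set true])).
Qed.

Lemma G_meas_le f g : G_meas G f -> G_meas G g -> G [set w | f w <= g w].
Proof.
move=> mf mg; rewrite (_ : [set w | _] = ~` [set w | g w < f w]).
  by apply: sub_sigmaC; exact: G_meas_lt.
by apply/seteqP; split=> w /=; rewrite leNgt => /negP.
Qed.

Lemma G_meas_comp_nat (k : T -> nat) (z : nat -> R) :
  (forall i, G [set w | k w = i]) -> G_meas G (z \o k).
Proof.
move=> Gk B mB; pose Q i := if z i \in B then [set w | k w = i] else set0.
rewrite (_ : _ @^-1` B = [set w | exists i, Q i w]).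
  by apply: sub_sigma_exists => i; rewrite /Q; case: ifP => // _; exact: sub_sigma0.
apply/seteqP; split=> w /= => [Bz|[i]]; first by exists (k w); rewrite /Q mem_set.
by rewrite /Q; case: ifPn => // /set_mem Bz /= ->.
Qed.

(* [find] returns [size s] when [w] lies in none of the sets indexed by [s]. *)
Lemma sub_sigma_find (Q : nat -> set T) (s : seq nat) i :
  (forall j, G (Q j)) -> G [set w | find (fun j => w \in Q j) s = i].
Proof.
move=> GQ; elim: s i => [|j s IH] i /=.
  have [->|i0] := eqVneq i 0%N.
    by rewrite (_ : [set w | _] = setT); [exact: sub_sigmaT|apply/seteqP; split].
  rewrite (_ : [set w | _] = set0); first exact: sub_sigma0.
  by apply/seteqP; split=> w //= /esym/eqP; rewrite (negbTE i0).
case: i => [|i].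
  rewrite (_ : [set _ | _] = Q j)//; apply/seteqP; split=> w /=.
    by case: ifPn => // /set_mem.
  by move=> Qw; rewrite mem_set.
rewrite (_ : [set _ | _] = [set w | find (fun j => w \in Q j) s = i] `\` Q j).
  exact: sub_sigmaD.
apply/seteqP; split=> w /=.
  by case: ifPn => // /negP wQ [<-]; split=> // /mem_set.
by move=> [<- nQ]; rewrite memNset.
Qed.

Lemma Linf_rep_cst c : Linf_rep G (cst c : T -> R).
Proof. by split; [exact: G_meas_cst|exists `|c|]. Qed.

Lemma Linf_rep_patch A f g : G A -> Linf_rep G f -> Linf_rep G g ->
  Linf_rep G (patch g A f).
Proof.
move=> GA [mf [M fM]] [mg [N gN]]; split; first exact: G_meas_patch.
by exists (Num.max M N) => w; exact: norm_patch_le.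
Qed.

Lemma Linf_rep_restrict A f : G A -> Linf_rep G f -> Linf_rep G (f \_ A).
Proof. by move=> GA Gf; apply: Linf_rep_patch => //; exact: Linf_rep_cst. Qed.

Lemma Linf_repW f : Linf_rep G f -> Linf f.
Proof. by move=> [mf bf]; split=> // B mB; apply: sG.2; exact: mf. Qed.

Lemma simple_approximation a b f : G_meas G f -> (forall w, a <= f w <= b) ->
  exists g : nat -> T -> R, [/\ forall n, G_meas G (g n),
    forall n, exists s : seq R, forall w, g n w \in s,
    forall n w, a <= g n w <= b & forall w, g n w @[n --> \oo] --> f w].
Proof.
move=> /G_measE mf fab.
have f0 (w : TG) : [set: TG] w -> (0 <= (f w - a)%:E)%E.
  by rewrite lee_fin subr_ge0 => _; case/andP: (fab w).
have mfa : measurable_fun [set: TG] (fun w : TG => (f w - a)%:E).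
  by apply/measurable_EFinP; exact: measurable_funB.
pose h n := nnsfun_approx measurableT mfa n.
exists (fun n w => a + h n w); split=> [n|n|n w|w].
- by apply/G_measE; apply: measurable_funD.
- have /finite_seqP[s hs] := fimfunP (h n).
  exists [seq a + x | x <- s] => w; apply: map_f.
  by have : range (h n) (h n w); [exists w|rewrite hs].
- rewrite lerDl fun_ge0/=; apply: le_trans (_ : f w <= b); last by case/andP: (fab w).
  by rewrite -lerBrDl -lee_fin nnsfun_approxE; exact: (le_approx n f0).
- rewrite -[f w](subrKC a); apply: cvgD; first exact: cvg_cst.
  by have /fine_cvgP[] := cvg_nnsfun_approx measurableT mfa f0 (I : [set: TG] w).
Qed.

End sub_sigma.

Section sub_sigma_bounds.
Context {d : measure_display} {T : measurableType d} {R : realType}.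

Lemma sub_sigmaF : sub_sigma (@Fsig d T).
Proof. by split => //; exact: sigma_algebra_measurable. Qed.

Lemma sub_sigma_triv : sub_sigma (@trivsig d T).
Proof.
split; last by move=> A [->|->]; rewrite /Fsig; [exact: measurable0|exact: measurableT].
split; [by left| |].
- by move=> A [->|->]; rewrite ?setD0 ?setDv; [right|left].
- move=> F F01; have [[n Fn]|/forallNP nF] := pselect (exists n, F n = setT).
    by right; apply/seteqP; split=> // w _; exists n; rewrite // Fn.
  by left; apply: bigcup0 => n _; case: (F01 n) => // /nF.
Qed.

Lemma trivsig_cst (f : T -> R) w w' : G_meas trivsig f -> f w = f w'.
Proof.
move=> /(_ [set f w] (measurable_set1 _))[ew|ew].
  by have : set0 w by rewrite -ew.
by have : setT w' by []; rewrite -ew /= => ->.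
Qed.

Lemma Linf_cst c : Linf (cst c : T -> R).
Proof. exact: (Linf_rep_cst sub_sigmaF). Qed.

Lemma Linf_patch (A : set T) (f g : T -> R) :
  measurable A -> Linf f -> Linf g -> Linf (patch g A f).
Proof. exact: (Linf_rep_patch sub_sigmaF). Qed.

Lemma Linf_restrict (A : set T) (f : T -> R) : measurable A -> Linf f -> Linf (f \_ A).
Proof. exact: (Linf_rep_restrict sub_sigmaF). Qed.

Lemma Linf_measurable (f : T -> R) : Linf f -> measurable_fun setT f.
Proof. by case=> mf _; exact: (G_meas_measurable sub_sigmaF). Qed.

Lemma measurable_Linf (f : T -> R) (M : R) :
  measurable_fun setT f -> (forall w, `|f w| <= M) -> Linf f.
Proof.
by move=> mf fM; split; [move=> B mB; rewrite -[X in Fsig X]setTI; exact: mf|exists M].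
Qed.

Lemma Linf_fiber (f : T -> R) x : Linf f -> measurable [set w | f w = x].
Proof. by case=> mf _; exact: (G_meas_fiber x mf). Qed.

End sub_sigma_bounds.
#[local] Hint Resolve Linf_cst : core.

(** * Intermediate values of set functions under a non-atomic probability *)

Section halving.
Context {R : realType}.
Implicit Types c x y : R.

Lemma cvg_div_exp2 c : c / 2 ^+ n @[n --> \oo] --> (0 : R).
Proof.
rewrite (_ : (fun n => _) = geometric c 2^-1); last first.
  by apply/funext => n; rewrite /= exprVn.
by apply: cvg_geometric; rewrite ger0_norm ?invr_ge0// invf_lt1 ?ltr1n.
Qed.

Lemma ler_addgt_div_exp2 c x y : (forall n, x <= y + c / 2 ^+ n) -> x <= y.
Proof.
move=> xy; have ylim : y + c / 2 ^+ n @[n --> \oo] --> y + 0.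
  by apply: cvgD; [exact: cvg_cst|exact: cvg_div_exp2].
by rewrite -[y]addr0; apply: (cvgr_to_ge ylim); exact: nearW.
Qed.

End halving.

Section almost_everywhere.
Context {d : measure_display} {T : measurableType d} {R : realType}.
Variable mu : {measure set T -> \bar R}.

Lemma ae_forall_count (C : countType) (Q : C -> T -> Prop) :
  (forall c, {ae mu, forall w, Q c w}) -> {ae mu, forall w, forall c, Q c w}.
Proof.
move=> aeQ.
have : {ae mu, forall w, forall n, if unpickle n is Some c then Q c w else True}.
  by apply/ae_foralln => n; case: (unpickle n) => [c|]; [exact: aeQ|exact: aeW].
by apply: filterS => w Qw c; have := Qw (pickle c); rewrite pickleK.
Qed.

Lemma null_set_ae A : measurable A -> mu A = 0%E -> {ae mu, forall w, ~ A w}.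
Proof. by move=> mA A0; exists A; split=> // w /= /contrapT. Qed.

End almost_everywhere.

Lemma ae_exists {d : measure_display} {T : measurableType d} {R : realType}
    (P : probability T R) (Q : T -> Prop) : {ae P, forall w, Q w} -> exists w, Q w.
Proof.
move=> [N [mN N0 QN]]; apply: contrapT => /forallNP nQ.
have NT : N = setT by apply/seteqP; split=> // w _; apply: QN; exact: nQ.
by move: N0; rewrite NT probability_setT => /eqP; rewrite onee_eq0.
Qed.

Section exhaustion.
Context {d : measure_display} {T : measurableType d} {R : realType}.
Variable mu : {finite_measure set T -> \bar R}.
Local Notation m A := (fine (mu A)).

Lemma fine_measureK A : measurable A -> (m A)%:E = mu A.
Proof. by move=> mA; rewrite fineK// fin_num_measure. Qed.

Lemma le_fine_measure A B : measurable A -> measurable B -> A `<=` B -> m A <= m B.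
Proof. by move=> mA mB AB; rewrite -lee_fin !fine_measureK// le_measure ?inE. Qed.

Lemma fine_measureU A B : measurable A -> measurable B -> A `&` B = set0 ->
  m (A `|` B) = m A + m B.
Proof. by move=> mA mB AB; rewrite measureU// fineD ?fin_num_measure. Qed.

Lemma exists_maximal_event (L : set (set T)) :
  L `<=` measurable -> L set0 ->
  (forall F, nondecreasing_seq F -> (forall n, L (F n)) -> L (\bigcup_n F n)) ->
  exists2 U, L U & forall K, L K -> U `<=` K -> m K <= m U.
Proof.
move=> Lmeas L0 Lcup.
pose masses H := [set m K | K in [set K | L K /\ H `<=` K]].
have masses_ub H : has_ubound (masses H).
  exists (m setT) => _ [K [LK _] <-].
  by apply: le_fine_measure => //; exact: Lmeas.
have /choice[next nextP] : forall H, exists K, L H ->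
    [/\ L K, H `<=` K & sup (masses H) <= 2 * m K - m H].
  move=> H; have [LH|nL] := pselect (L H); last by exists H.
  have HH : masses H (m H) by exists H => //; split.
  have [lt|ge] := ltP (m H) (sup (masses H)); last by exists H => _; split=> //; lra.
  have e0 : 0 < (sup (masses H) - m H) / 2 by rewrite divr_gt0 ?subr_gt0.
  have [|_ [K [LK HK] <-] ltK] := sup_adherent e0 (E := masses H).
    by split=> //; exists (m H).
  by exists K => _; split=> //; lra.
pose F n := iter n next set0.
have LF n : L (F n) by elim: n => [//|n IH]; case: (nextP _ IH).
have mF n := Lmeas _ (LF n).
have Fnd : nondecreasing_seq F.
  apply/nondecreasing_seqP => n; apply/subsetPset.
  by have [_ + _] := nextP _ (LF n).
have mU : measurable (\bigcup_n F n) by exact: bigcupT_measurable.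
exists (\bigcup_n F n) => [|K LK UK]; first exact: Lcup.
have Flim : m (F n) @[n --> \oo] --> m (\bigcup_n F n).
  by apply: fine_cvg; rewrite fine_measureK//; exact: nondecreasing_cvg_mu.
have gaplim : 2 * m (F n.+1) - m (F n) @[n --> \oo] -->
    2 * m (\bigcup_n F n) - m (\bigcup_n F n).
  apply: cvgB => //; apply: cvgM; first exact: cvg_cst.
  by rewrite (cvg_shiftS (fun n => m (F n))).
suff : m K <= 2 * m (\bigcup_n F n) - m (\bigcup_n F n) by lra.
apply: (cvgr_to_ge gaplim); apply: nearW => n.
have [_ _] := nextP _ (LF n); apply: le_trans; apply: ub_le_sup => //.
by exists K => //; split=> //; apply: subset_trans UK; exact: bigcup_sup.
Qed.

End exhaustion.

Section set_continuous.
Context {d : measure_display} {T : measurableType d} {R : realType}.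
Variable P : probability T R.
Implicit Types (A B H : set T) (J : (T -> R) -> R).

Definition set_continuous (g : set T -> R) :=
  forall (S : nat -> set T) S0, (forall n, measurable (S n)) -> measurable S0 ->
  {ae P, forall w, \forall n \near \oo, S n w <-> S0 w} ->
  g (S n) @[n --> \oo] --> g S0.

Definition dominated_continuous J :=
  forall (X : nat -> T -> R) f, (forall n, Linf (X n)) -> Linf f ->
    (exists M : R, forall n w, `|X n w| <= M) ->
    {ae P, forall w, X n w @[n --> \oo] --> f w} -> J (X n) @[n --> \oo] --> J f.

Lemma dominated_continuous_patch J f g : dominated_continuous J -> Linf f -> Linf g ->
  set_continuous (fun S => J (patch g S f)).
Proof.
move=> cJ Lf Lg S S0 mS mS0 SS0; have [_ [M fM]] := Lf; have [_ [N gN]] := Lg.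
apply: cJ => [n|||]; [exact: Linf_patch|exact: Linf_patch| |].
  by exists (Num.max M N) => n w; exact: norm_patch_le.
apply: filterS SS0 => w Sw; apply: cvg_near_cst; apply: filterS Sw => n Sn.
rewrite /patch (_ : (w \in S n) = (w \in S0))//.
by apply/idP/idP => /set_mem/Sn; rewrite inE.
Qed.

Lemma set_continuousB g h : set_continuous g -> set_continuous h ->
  set_continuous (g \- h).
Proof. by move=> cg ch S S0 mS mS0 SS0; apply: cvgB; [exact: cg|exact: ch]. Qed.

Lemma set_continuousD A g : measurable A -> set_continuous g ->
  set_continuous (fun S => g (A `\` S)).
Proof.
move=> mA cg S S0 mS mS0 SS0; apply: cg => [n||]; [exact: measurableD..|].
by apply: filterS SS0 => w; apply: filterS => n e; split=> -[Aw nS]; split=> // /e.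
Qed.

Lemma set_continuousU A g : measurable A -> set_continuous g ->
  set_continuous (fun S => g (A `|` S)).
Proof.
move=> mA cg S S0 mS mS0 SS0; apply: cg => [n||]; [exact: measurableU..|].
apply: filterS SS0 => w; apply: filterS => n e.
by split=> -[Aw|/e Sw]; [left|right|left|right].
Qed.

Lemma set_continuous_ae g A B : set_continuous g -> measurable A -> measurable B ->
  {ae P, forall w, A w <-> B w} -> g A = g B.
Proof.
move=> cg mA mB AB; have gAB : g A @[_ --> \oo] --> g B.
  by apply: cg => //; apply: filterS AB => w AB; exact: nearW.
exact: cvg_unique (cvg_cst (g A)) gAB.
Qed.

Lemma set_continuous_bigcup g (S : nat -> set T) : set_continuous g ->
  (forall n, measurable (S n)) -> nondecreasing_seq S ->
  g (S n) @[n --> \oo] --> g (\bigcup_n S n).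
Proof.
move=> cg mS ndS; apply: cg => //; first exact: bigcupT_measurable.
apply: aeW => w; have [[n _ Snw]|nS] := pselect ((\bigcup_n S n) w).
  exists n => // m /= nm; split=> [|_]; first by exists m.
  by have /subsetPset := ndS _ _ nm; exact.
by apply: nearW => m; split=> // Smw; case: nS; exists m.
Qed.

End set_continuous.

Section nonatomic.
Context {d : measure_display} {T : measurableType d} {R : realType}.
Variable P : probability T R.
Hypothesis naP : nonatomic P.
Local Notation pr A := (fine (P A)).
Implicit Types (A B H : set T) (g : set T -> R).

Lemma fine_probability_gt0 A : measurable A -> (0 < P A)%E = (0 < pr A).
Proof. by move=> mA; rewrite -lte_fin fine_measureK. Qed.

Lemma exists_half_event A : measurable A -> (0 < P A)%E ->
  exists B, [/\ measurable B, B `<=` A, (0 < P B)%E & pr B <= pr A / 2].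
Proof.
move=> mA A0; have [B [mB BA B0 BltA]] := naP mA A0.
have mD : measurable (A `\` B) by exact: measurableD.
have AE : pr A = pr B + pr (A `\` B).
  by rewrite -fine_measureU ?setDUK// setDIK.
have [h|h] := leP (pr B) (pr A / 2); first by exists B.
exists (A `\` B); split; [exact: mD|exact: subDsetl| |lra].
move: BltA; rewrite -fine_measureK// -[X in (_ < X)%E]fine_measureK// lte_fin.
by rewrite fine_probability_gt0//; lra.
Qed.

Lemma exists_small_event n A : measurable A -> (0 < P A)%E ->
  exists B, [/\ measurable B, B `<=` A, (0 < P B)%E & pr B <= pr A / 2 ^+ n].
Proof.
move=> mA A0; elim: n => [|n [B [mB BA B0 Bn]]].
  by exists A; split=> //; rewrite expr0 divr1.
have [C [mC CB C0 Cle]] := exists_half_event mB B0.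
exists C; split=> //; first exact: subset_trans CB BA.
by apply: (le_trans Cle); rewrite exprSr invfM mulrA ler_pM2r.
Qed.

(* Borel-Cantelli for events of probability at most [2 ^ - n.+1] *)
Lemma exists_vanishing_events A : measurable A -> (0 < P A)%E ->
  exists C : nat -> set T,
    (forall n, [/\ measurable (C n), C n `<=` A & (0 < P (C n))%E]) /\
    {ae P, forall w, \forall n \near \oo, ~ C n w}.
Proof.
move=> mA A0; have /choice[C CP] := fun n => exists_small_event n.+1 mA A0.
have mC n : measurable (C n) by case: (CP n).
exists C; split=> [n|]; first by case: (CP n).
have : P (lim_sup_set C) = 0%E.
  apply: lim_sup_set_cvg0 => //; apply: le_lt_trans (ltry (pr A)).
  apply: le_trans (epsilon_trick0 xpredT (fine_ge0 (measure_ge0 P A))).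
  apply: lee_nneseries => n _ //.
  by have [_ _ _] := CP n; rewrite -lee_fin fine_measureK// -natrX.
have mlim : measurable (lim_sup_set C).
  by apply: bigcapT_measurable => n; exact: bigcup_measurable.
move=> /(null_set_ae mlim); apply: filterS => w nC.
apply: contrapT => nC'; apply: nC => n _; apply: contrapT => nCn; apply: nC'.
by exists n => // m /= nm Cmw; apply: nCn; exists m.
Qed.

Lemma set_continuous_ivt g A c : set_continuous P g -> measurable A ->
  g set0 <= c <= g A -> exists H, [/\ measurable H, H `<=` A & g H = c].
Proof.
move=> cg mA /andP[g0 gA].
pose L H := [/\ measurable H, H `<=` A & g H <= c].
have [|||U [mU UA gU] Umax] := @exists_maximal_event _ _ _ P L.
- by move=> H [].
- by split.
- move=> F Fnd LF; have mF n : measurable (F n) by case: (LF n).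
  split; first exact: bigcupT_measurable.
    by apply: bigcup_sub => n _; case: (LF n).
  apply: (cvgr_to_le (set_continuous_bigcup cg mF Fnd)).
  by apply: nearW => n; case: (LF n).
exists U; split=> //; apply/eqP; rewrite eq_le gU/= leNgt; apply/negP => gUc.
have mD : measurable (A `\` U) by exact: measurableD.
have D0 : (0 < P (A `\` U))%E.
  rewrite measure_gt0; apply/eqP => D0; move: gA.
  rewrite leNgt (_ : g A = g U) ?gUc//.
  apply: (set_continuous_ae cg) => //.
  have := null_set_ae mD D0; apply: filterS => w nDw.
  by split=> [Aw|/UA//]; apply: contrapT => nUw; exact: nDw.
have [C [CP Cvan]] := exists_vanishing_events mD D0.
have gUC : g (U `|` C n) @[n --> \oo] --> g (U `|` set0).
  apply: (set_continuousU mU cg) => // [n|]; first by case: (CP n).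
  by apply: filterS Cvan => w; apply: filterS => n nC; split.
rewrite setU0 in gUC; near \oo => n; have [mC CD C0] := CP n.
have gUCn : g (U `|` C n) <= c by apply: ltW; near: n; exact: (cvgr_lt _ gUC).
have : pr (U `|` C n) <= pr U.
  apply: Umax; last by left.
  by split=> //; [exact: measurableU|move=> w [/UA//|/CD[]]].
rewrite fine_measureU//; last by rewrite -subset0 => w [Uw /CD[]].
by rewrite leNgt ltrDl -fine_probability_gt0// C0.
Unshelve. all: by end_near. Qed.

End nonatomic.

(** * Dyadic subdivision of a qualitative probability *)

Section qualitative_probability.
Context {d : measure_display} {T : measurableType d} {R : realType}.
Variable P : probability T R.

Record qualitative_probability (q : set T -> R) : Prop := QualitativeProbability {
  qual_cont : set_continuous P q;
  qual_gt0 : forall S, measurable S -> (0 < P S)%E -> q set0 < q S;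
  qual_leU : forall S S' C, measurable S -> measurable S' -> measurable C ->
    S `&` C = set0 -> S' `&` C = set0 -> (q (S `|` C) <= q (S' `|` C)) = (q S <= q S') }.

Variable q : set T -> R.
Hypothesis qualq : qualitative_probability q.
Implicit Types A B C S : set T.

Lemma qual_leifU S S' C c : measurable S -> measurable S' -> measurable C ->
  S `&` C = set0 -> S' `&` C = set0 ->
  (q (S `|` C) <= q (S' `|` C) ?= iff c) <-> (q S <= q S' ?= iff c).
Proof.
move=> mS mS' mC SC S'C.
by rewrite /Order.leif !eq_le !(qual_leU qualq).
Qed.

Lemma qual_null S : measurable S -> P S = 0%E -> q S = q set0.
Proof.
move=> mS S0; apply: (set_continuous_ae (qual_cont qualq)) => //.
by apply: filterS (null_set_ae mS S0).
Qed.

Lemma qual_ge0 S : measurable S -> q set0 <= q S.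
Proof.
move=> mS; have [S0|S0] := eqVneq (P S) 0%E; first by rewrite qual_null.
by apply/ltW/(qual_gt0 qualq) => //; rewrite measure_gt0.
Qed.

Lemma qual_le S S' : measurable S -> measurable S' -> S `<=` S' -> q S <= q S'.
Proof.
move=> mS mS' SS'; have mD : measurable (S' `\` S) by exact: measurableD.
rewrite -(setDUK SS') setUC -[q S](congr1 q (set0U S)).
by rewrite (qual_leU qualq)// ?set0I// ?setDKI//; exact: qual_ge0.
Qed.

Lemma qual_itv S : measurable S -> q set0 <= q S <= q setT.
Proof. by move=> mS; rewrite qual_ge0// qual_le. Qed.

(* Both sides are compared with [S' `|` (B `\` S')] after removing [S' `&` B]. *)
Lemma qual_leif_add S S' B B' : measurable S -> measurable S' -> measurable B ->
  measurable B' -> S `&` S' = set0 -> B `&` B' = set0 -> q S <= q B -> q S' <= q B' ->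
  q (S `|` S') <= q (B `|` B') ?= iff (q S == q B) && (q S' == q B').
Proof.
move=> mS mS' mB mB' SS' BB' SB S'B'.
have mS'B : measurable (S' `\` B) by exact: measurableD.
have mBS' : measurable (B `\` S') by exact: measurableD.
have leS : q (S `|` (S' `\` B)) <= q (B `|` (S' `\` B)) ?= iff (q S == q B).
  apply/qual_leifU => //; [|exact: setDIK].
  by rewrite setIDA SS' set0D.
have leS' : q (S' `|` (B `\` S')) <= q (B' `|` (B `\` S')) ?= iff (q S' == q B').
  apply/qual_leifU => //; [exact: setDIK|].
  by rewrite setIDA (setIC B') BB' set0D.
have BS'E : B `|` (S' `\` B) = S' `|` (B `\` S') by rewrite !setUDr !setDv !setD0 setUC.
rewrite BS'E in leS.
suff : q (S `|` (S' `\` B) `|` (S' `&` B)) <= q (B' `|` (B `\` S') `|` (S' `&` B))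
    ?= iff (q S == q B) && (q S' == q B').
  rewrite -setUA (setUC (S' `\` B)) setUIDK -setUA (setIC S').
  by rewrite (setUC (B `\` S')) setUIDK (setUC B').
apply/qual_leifU; last exact: leif_trans leS leS'.
- exact: measurableU.
- exact: measurableU.
- exact: measurableI.
- by rewrite setIUl setIA SS' set0I set0U setICA setDKI setI0.
- by rewrite setIUl setICA (setIC B') BB' setI0 set0U setIA setDKI set0I.
Qed.

End qualitative_probability.

Section dyadic_subdivision.
Context {d : measure_display} {T : measurableType d} {R : realType}.
Variable P : probability T R.
Hypothesis naP : nonatomic P.
Variable q : set T -> R.
Hypothesis qualq : qualitative_probability P q.
Implicit Types A B S : set T.

Lemma qual_ivt A x : measurable A -> q set0 <= x <= q A ->
  exists S, [/\ measurable S, S `<=` A & q S = x].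
Proof. by move=> mA Ax; apply: (set_continuous_ivt naP (qual_cont qualq) mA). Qed.

Lemma exists_qual_half A : measurable A ->
  exists S, [/\ measurable S, S `<=` A & q S = q (A `\` S)].
Proof.
move=> mA; pose gap S := q S - q (A `\` S).
have gap_cont : set_continuous P gap.
  by apply: set_continuousB (set_continuousD mA _); exact: (qual_cont qualq).
have [|S [mS SA /subr0_eq Sc]] := set_continuous_ivt naP gap_cont mA (c := 0).
  by rewrite /gap setD0 setDv subr_le0 subr_ge0 !(qual_ge0 qualq).
by exists S.
Qed.

Definition half_event A : set T := xget set0
  [set S | S `<=` A /\ (measurable A -> measurable S /\ q S = q (A `\` S))].

Lemma half_eventP A :
  half_event A `<=` A /\
  (measurable A -> measurable (half_event A) /\ q (half_event A) = q (A `\` half_event A)).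
Proof.
rewrite /half_event; case: xgetP => [S _ //|nS].
have [/exists_qual_half[S [mS SA qS]]|nA] := pselect (measurable A).
  by case: (nS S); split.
by case: (nS set0); split.
Qed.

Lemma half_event_sub A : half_event A `<=` A. Proof. by case: (half_eventP A). Qed.

Lemma half_event_measurable A : measurable A -> measurable (half_event A).
Proof. by move=> mA; case: (half_eventP A) => _ /(_ mA)[]. Qed.

Lemma qual_halfC A : measurable A -> q (A `\` half_event A) = q (half_event A).
Proof. by move=> mA; case: (half_eventP A) => _ /(_ mA)[]. Qed.

Lemma qual_half_le A B : measurable A -> measurable B -> q A <= q B ->
  q (half_event A) <= q (half_event B).
Proof.
move=> mA mB; rewrite [q (half_event A) <= _]leNgt; apply: contraL => BA.
have [mhA mhB] := (half_event_measurable mA, half_event_measurable mB).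
rewrite -ltNge -(setDUK (@half_event_sub A)) -(setDUK (@half_event_sub B)).
rewrite (lt_leif (qual_leif_add qualq _ _ _ _ _ _ _ _))//.
all: rewrite ?setDIK ?qual_halfC// ?(ltW BA)//; do ?exact: measurableD.
by rewrite lt_eqF.
Qed.

Lemma qual_half_gt0 A : measurable A -> q set0 < q A -> q set0 < q (half_event A).
Proof.
move=> mA; rewrite !ltNge; apply: contraNN => A0; have mhA := half_event_measurable mA.
rewrite -(setDUK (@half_event_sub A)) -[q set0](congr1 q (setU0 set0)).
rewrite (qual_leif_add qualq)// ?setDIK ?set0I ?qual_halfC//; exact: measurableD.
Qed.

(* Binary address of a point at level [n]: each new digit tells whether the point lies
   outside the half of its cell. *)
Fixpoint address n w : nat :=
  if n is n'.+1 then
    (w \notin half_event [set v | address n' v = address n' w]) + (address n' w).*2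
  else 0.

Definition cell n k : set T := [set w | address n w = k].

Definition block n i k : set T := [set w | (i <= address n w < k)%N].

Lemma half_address n w : (address n.+1 w)./2 = address n w.
Proof. exact: half_bit_double. Qed.

Lemma address_lt n w : (address n w < 2 ^ n)%N.
Proof. by elim: n => // n IH; rewrite expnS mul2n -ltn_half_double half_address. Qed.

Lemma cellS n k : cell n.+1 k =
  if odd k then cell n k./2 `\` half_event (cell n k./2) else half_event (cell n k./2).
Proof.
have odd_address w : odd (address n.+1 w) = (w \notin half_event (cell n (address n w))).
  by rewrite oddD odd_double addbF oddb.
apply/seteqP; split=> w.
  move=> /= <-; rewrite half_address odd_address.
  by case: ifPn => [/negP nw|/negPn/set_mem//]; split=> // /mem_set.
rewrite /cell /= => kw; rewrite -(odd_double_half k); move: kw.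
case: ifPn => [ok [<- nw]|ek hw].
  by rewrite memNset.
by have /= <- := half_event_sub hw; rewrite mem_set// (half_event_sub hw).
Qed.

Lemma cell_measurable n k : measurable (cell n k).
Proof.
elim: n k => [|n IH] k; last first.
  rewrite cellS; have mhalf := half_event_measurable (IH k./2).
  by case: ifP => _ //; exact: measurableD.
case: k => [|k].
  by rewrite (_ : cell 0 0 = setT)//; apply/seteqP; split.
by rewrite (_ : cell 0 _ = set0)//; apply/seteqP; split.
Qed.

Lemma block_measurable n i k : measurable (block n i k).
Proof.
rewrite (_ : block n i k = \bigcup_(j in [set j | (i <= j < k)%N]) cell n j).
  by apply: bigcup_measurable => j _; exact: cell_measurable.
apply/seteqP; split=> w => [wik|[j /= jk wj]]; first by exists (address n w).
by rewrite /block /= [address n w]wj.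
Qed.

Local Hint Resolve cell_measurable block_measurable half_event_measurable : core.

Lemma blocknn n i : block n i i = set0.
Proof.
apply/seteqP; split=> // w /= /andP[ia ai].
by have := leq_ltn_trans ia ai; rewrite ltnn.
Qed.

Lemma block_cat n i k m : (i <= k <= m)%N -> block n i m = block n i k `|` block n k m.
Proof.
move=> /andP[ik km]; rewrite /block; apply/seteqP; split=> w /=.
  by move=> /andP[ia am]; have [ak|ka] := ltnP (address n w) k; [left|right]; apply/andP.
by move=> [/andP[-> /leq_trans->]|/andP[/(leq_trans ik)->]].
Qed.

Lemma block1 n i : block n i i.+1 = cell n i.
Proof.
rewrite /block /cell; apply/seteqP; split=> w /= => [|->]; rewrite ltnS ?leqnn//.
by rewrite -eqn_leq => /eqP->.
Qed.

Lemma blockS n k : block n 0 k.+1 = block n 0 k `|` cell n k.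
Proof. by rewrite (@block_cat n 0 k)// ?block1 ?leqnSn. Qed.

Lemma block_disj n i k m : block n i k `&` block n k m = set0.
Proof.
by rewrite -subset0 => w [/= /andP[_ ak] /andP[/(leq_trans ak)]]; rewrite ltnn.
Qed.

Lemma block_scale n m i k : block (m + n) (2 ^ m * i) (2 ^ m * k) = block n i k.
Proof.
elim: m => [|m IH]; first by rewrite !mul1n.
rewrite -IH addSn !expnS -!mulnA !mul2n /block; apply: eq_set => w.
by rewrite -geq_half_double -ltn_half_double half_address.
Qed.

Lemma block_full n k : (2 ^ n <= k)%N -> block n 0 k = setT.
Proof.
by move=> nk; apply/seteqP; split=> w //= _; exact: leq_trans (address_lt n w) nk.
Qed.

Lemma qual_cell n j k : (j < 2 ^ n)%N -> (k < 2 ^ n)%N -> q (cell n j) = q (cell n k).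
Proof.
elim: n j k => [|n IH] j k; first by rewrite !ltnS !leqn0 => /eqP-> /eqP->.
have qcell i : q (cell n.+1 i) = q (half_event (cell n i./2)).
  by rewrite cellS; case: ifP => _ //; rewrite qual_halfC.
rewrite expnS mul2n -!ltn_half_double => jn kn; rewrite !qcell.
by apply/eqP; rewrite eq_le !qual_half_le// (IH _ _ jn kn).
Qed.

Lemma qual_cell_gt0 n k : (k < 2 ^ n)%N -> q set0 < q (cell n k).
Proof.
elim: n k => [|n IH] k.
  rewrite ltnS leqn0 => /eqP->; rewrite -block1 block_full//.
  by apply: (qual_gt0 qualq) => //; rewrite probability_setT lte01.
rewrite expnS mul2n -ltn_half_double => /IH lt; rewrite cellS.
by case: ifP => _; rewrite ?qual_halfC//; exact: qual_half_gt0.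
Qed.

Lemma qual_block n i m : (i + m <= 2 ^ n)%N -> q (block n i (i + m)) = q (block n 0 m).
Proof.
elim: m => [|m IH] imn; first by rewrite addn0 !blocknn.
have im : (i + m < 2 ^ n)%N by rewrite -addnS.
rewrite addnS (@block_cat n i (i + m)) ?leq_addr ?leqnSn// blockS block1.
have qb := IH (ltnW im).
have qc : q (cell n (i + m)) = q (cell n m).
  by apply: qual_cell => //; apply: leq_ltn_trans im; exact: leq_addl.
have := qual_leif_add qualq (S := block n i (i + m)) (S' := cell n (i + m))
  (B := block n 0 m) (B' := cell n m).
rewrite -!block1 !block_disj !block1 qb qc lexx eqxx => -[]// _.
by rewrite eqxx => /eqP.
Qed.

Lemma qual_block_le n k m : (k <= m)%N -> q (block n 0 k) <= q (block n 0 m).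
Proof.
by move=> km; apply: (qual_le qualq) => // w /=; move=> /leq_trans; exact.
Qed.

Lemma qual_block_lt n k m : (k < m)%N -> (m <= 2 ^ n)%N ->
  q (block n 0 k) < q (block n 0 m).
Proof.
move=> km mn; apply: lt_le_trans (qual_block_le n km).
rewrite -[X in q X < _]setU0 blockS.
rewrite (lt_leif (qual_leif_add qualq _ _ _ _ _ _ _ _))// ?setI0 -?block1 ?block_disj//.
- by rewrite eqxx block1 lt_eqF// qual_cell_gt0// (leq_trans km).
- exact: (qual_ge0 qualq).
Qed.

(* Blocks of different levels are compared after refining both to level [n + m]. *)
Lemma qual_block_leP n k m j : (j <= 2 ^ m)%N ->
  q (block m 0 j) <= q (block n 0 k) -> (2 ^ n * j <= 2 ^ m * k)%N.
Proof.
move=> jm; rewrite -(block_scale m n 0 j) -(block_scale n m 0 k) !muln0 (addnC m).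
have jmn : (2 ^ n * j <= 2 ^ (n + m))%N by rewrite expnD leq_mul2l jm orbT.
by apply: contraTT; rewrite -ltNge -ltnNge => kj; exact: qual_block_lt.
Qed.

Lemma qual_block_bracket n x : q set0 <= x <= q setT ->
  exists2 k, (k < 2 ^ n)%N & q (block n 0 k) <= x <= q (block n 0 k.+1).
Proof.
move=> /andP[x0 xT].
suff bracket m : x <= q (block n 0 m.+1) ->
    exists2 k, (k < m.+1)%N & q (block n 0 k) <= x <= q (block n 0 k.+1).
  have := bracket (2 ^ n).-1; rewrite prednK ?expn_gt0// block_full//; exact.
elim: m => [|m IH] xm; first by exists 0%N; rewrite // blocknn x0.
have [/IH[k km kx]|mx] := leP x (q (block n 0 m.+1)).
  by exists k => //; exact: ltnW.
by exists m.+1; rewrite // xm (ltW mx).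
Qed.

Lemma address_eq0W m n w : (m <= n)%N -> address n w = 0%N -> address m w = 0%N.
Proof.
move=> /subnK <-; elim: (n - m)%N => // k IH /(congr1 half).
by rewrite addSn half_address; exact: IH.
Qed.

(* The cells of index 1 of all levels are pairwise disjoint. *)
Lemma qual_cell_vanish x : q set0 < x -> exists n, q (cell n 0) < x.
Proof.
move=> x0.
have uniq_level m n w : (m < n)%N -> cell m.+1 1 w -> ~ cell n.+1 1 w.
  move=> mn wm wn; have wn0 : address n w = 0%N by rewrite -half_address [address _ _]wn.
  by have := address_eq0W mn wn0; rewrite [address _ _]wm.
have qlim : q (cell n.+1 1) @[n --> \oo] --> q set0.
  apply: (qual_cont qualq) => //; apply: aeW => w.
  have [[m wm]|nw] := pselect (exists m, cell m.+1 1 w).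
    by exists m.+1 => // n /= mn; split=> // wn; exact: uniq_level wm wn.
  by apply: nearW => n; split=> // wn; apply: nw; exists n.
near \oo => n; exists n.+1.
rewrite (@qual_cell n.+1 0 1) ?expn_gt0//; last by rewrite (@ltn_exp2l 2 0).
by near: n; exact: (cvgr_lt _ qlim).
Unshelve. all: by end_near. Qed.

End dyadic_subdivision.

(** * The additive scale of a qualitative probability *)

Section scale.
Context {d : measure_display} {T : measurableType d} {R : realType}.
Variable P : probability T R.
Hypothesis naP : nonatomic P.
Variable q : set T -> R.
Hypothesis qualq : qualitative_probability P q.
Local Notation block := (block q).
Local Notation cell := (cell q).
Implicit Types S : set T.

Let block_measurable n i k : measurable (block n i k).
Proof. exact: (block_measurable naP qualq). Qed.

Let cell_measurable n k : measurable (cell n k).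
Proof. exact: (cell_measurable naP qualq). Qed.

Local Hint Resolve block_measurable cell_measurable : core.

(* The proportion of cells, over all levels, that fit below the value [x] of [q] *)
Definition scale (x : R) : R := sup [set r | exists n k,
  [/\ (k <= 2 ^ n)%N, q (block n 0 k) <= x & r = k%:R / 2 ^+ n]].

Let exp2_gt0 n : 0 < 2 ^+ n :> R. Proof. exact: exprn_gt0. Qed.
Local Hint Resolve exp2_gt0 : core.

Lemma scale_ge n k x : (k <= 2 ^ n)%N -> q (block n 0 k) <= x ->
  k%:R / 2 ^+ n <= scale x.
Proof.
move=> kn kx; apply: ub_le_sup; last by exists n, k.
by exists 1 => _ [m [j [jm _ ->]]]; rewrite ler_pdivrMr// mul1r -natrX ler_nat.
Qed.

Lemma scale_le n k x : q set0 <= x <= q (block n 0 k) -> scale x <= k%:R / 2 ^+ n.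
Proof.
move=> /andP[x0 xk]; apply: ge_sup.
  by exists (0%:R / 2 ^+ 0), 0%N, 0%N; rewrite blocknn.
move=> _ [m [j [jm jx ->]]]; have := qual_block_leP naP qualq jm (le_trans jx xk).
by rewrite ler_pdivrMr// mulrAC ler_pdivlMr// -!natrX -!natrM ler_nat mulnC (mulnC k).
Qed.

Lemma scale_block n k : (k <= 2 ^ n)%N -> scale (q (block n 0 k)) = k%:R / 2 ^+ n.
Proof.
by move=> kn; apply/eqP; rewrite eq_le scale_ge// scale_le// lexx (qual_ge0 qualq).
Qed.

Lemma scaleT : scale (q setT) = 1.
Proof. by rewrite -(@block_full _ _ _ q 0 1)// scale_block// divr1. Qed.

Lemma scale_nd x y : q set0 <= x -> x <= y -> scale x <= scale y.
Proof.
move=> x0 xy; apply: ge_sup; first by exists (0%:R / 2 ^+ 0), 0%N, 0%N; rewrite blocknn.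
by move=> _ [n [k [kn kx ->]]]; apply: scale_ge => //; exact: le_trans xy.
Qed.

Lemma scale_bracket n x : q set0 <= x <= q setT -> exists k, [/\ (k < 2 ^ n)%N,
  q (block n 0 k) <= x <= q (block n 0 k.+1) &
  k%:R / 2 ^+ n <= scale x <= k%:R / 2 ^+ n + 1 / 2 ^+ n].
Proof.
move=> x0T; have [k kn kx] := qual_block_bracket n x0T.
have /andP[kx1 kx2] := kx; have /andP[x0 _] := x0T; exists k; split=> //.
by rewrite scale_ge ?(ltnW kn)//= -mulrDl natr1 scale_le// x0.
Qed.

Lemma block_superadditive n k j S S' :
  measurable S -> measurable S' -> S `&` S' = set0 ->
  (k <= 2 ^ n)%N -> (j <= 2 ^ n)%N ->
  q (block n 0 k) <= q S -> q (block n 0 j) <= q S' ->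
  (k + j <= 2 ^ n)%N /\ q (block n 0 (k + j)) <= q (S `|` S').
Proof.
move=> mS mS' SS' kn jn kS jS'.
have leif_block i : (k + i <= 2 ^ n)%N -> (i <= j)%N ->
    q (block n 0 (k + i)) <= q (S `|` S')
      ?= iff (q (block n 0 k) == q S) && (q (block n 0 i) == q S').
  move=> kin ij; rewrite (@block_cat _ _ _ q n 0 k) ?leq_addr//.
  rewrite -(qual_block naP qualq kin); apply: (qual_leif_add qualq) => //.
    exact: block_disj.
  rewrite (qual_block naP qualq)//; apply: le_trans jS'.
  exact: (qual_block_le naP qualq).
suff kjn : (k + j <= 2 ^ n)%N by split=> //; case: (leif_block j).
rewrite leqNgt; apply/negP => kjn; pose i := (2 ^ n - k)%N.
have kin : (k + i)%N = (2 ^ n)%N by rewrite subnKC.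
have ij : (i < j)%N by rewrite ltn_subLR.
have iS' : q (block n 0 i) < q S'.
  by apply: lt_le_trans jS'; exact: (qual_block_lt naP qualq).
have : q (block n 0 (k + i)) < q (S `|` S').
  by rewrite (lt_leif (leif_block i _ _)) ?kin ?(ltnW ij)// (lt_eqF iS') andbF.
rewrite kin block_full// ltNge; apply/negP; rewrite negbK.
by apply: (qual_le qualq) => //; exact: measurableU.
Qed.

Lemma block_subadditive n k j S S' : measurable S -> measurable S' -> S `&` S' = set0 ->
  q S <= q (block n 0 k) -> q S' <= q (block n 0 j) ->
  q (S `|` S') <= q (block n 0 (k + j)).
Proof.
move=> mS mS' SS' Sk S'j; have mU : measurable (S `|` S') by exact: measurableU.
have [kjn|/ltnW kjn] := leqP (k + j) (2 ^ n); last first.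
  by rewrite block_full//; exact: (qual_le qualq).
rewrite (@block_cat _ _ _ q n 0 k) ?leq_addr//.
have := qual_leif_add qualq mS mS' (block_measurable n 0 k) (block_measurable n k (k + j)).
by rewrite block_disj (qual_block naP qualq) => // /(_ SS' erefl Sk S'j)[].
Qed.

Lemma scale_setU S S' : measurable S -> measurable S' -> S `&` S' = set0 ->
  scale (q (S `|` S')) = scale (q S) + scale (q S').
Proof.
move=> mS mS' SS'.
have S0T := qual_itv qualq mS; have S'0T := qual_itv qualq mS'.
suff close n : scale (q S) + scale (q S') - 2 / 2 ^+ n <= scale (q (S `|` S'))
    <= scale (q S) + scale (q S') + 2 / 2 ^+ n.
  apply/eqP; rewrite eq_le; apply/andP; split.
    by apply: (@ler_addgt_div_exp2 _ 2) => n; case/andP: (close n).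
  by apply: (@ler_addgt_div_exp2 _ 2) => n; rewrite -lerBlDr; case/andP: (close n).
have [k [kn /andP[k1 k2] /andP[k3 k4]]] := scale_bracket n S0T.
have [j [jn /andP[j1 j2] /andP[j3 j4]]] := scale_bracket n S'0T.
have [kjn lower] := block_superadditive mS mS' SS' (ltnW kn) (ltnW jn) k1 j1.
have upper := block_subadditive mS mS' SS' k2 j2.
have := scale_ge kjn lower; have := @scale_le n (k.+1 + j.+1) (q (S `|` S')).
rewrite upper (qual_ge0 qualq) ?andbT//=; last exact: measurableU.
by move=> /(_ isT); rewrite !natrD -(natr1 k) -(natr1 j) !mulrDl; lra.
Qed.

Lemma scale_gt0 x : q set0 < x -> 0 < scale x.
Proof.
move=> x0; have [n nx] := qual_cell_vanish naP qualq x0.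
apply: lt_le_trans (_ : 1%:R / 2 ^+ n <= _); first by rewrite divr_gt0.
by apply: scale_ge; rewrite ?expn_gt0// block1 ltW.
Qed.

Lemma scale_lt x y : q set0 <= x -> x < y -> y <= q setT -> scale x < scale y.
Proof.
move=> x0 xy yT.
have [|S [mS _ qS]] := qual_ivt naP qualq measurableT (x := x).
  by rewrite x0 (le_trans (ltW xy)).
have mSC : measurable (~` S) by exact: measurableC.
have [|H [mH HS qSH]] :=
    set_continuous_ivt naP (set_continuousU mS (qual_cont qualq)) mSC (c := y).
  by rewrite setU0 setUv qS ltW.
have SH : S `&` H = set0 by rewrite -subset0 => w [Sw /HS].
rewrite -qSH scale_setU// qS ltrDl scale_gt0// lt_neqAle (qual_ge0 qualq)// andbT.
apply/eqP => H0; have : q (S `|` H) <= q (S `|` set0).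
  by rewrite (qual_leif_add qualq)// ?setI0// H0.
by rewrite setU0 qSH qS leNgt xy.
Qed.

Lemma exists_dyadic_between (s t : R) : 0 <= s -> s < t -> t <= 1 ->
  exists n k, (k <= 2 ^ n)%N /\ s < k%:R / 2 ^+ n < t.
Proof.
move=> s0 st t1.
have [n nst] : exists n, 1 / 2 ^+ n < t - s.
  have ts0 : 0 < t - s by rewrite subr_gt0.
  near \oo => n; exists n; near: n; exact: (cvgr_lt _ (cvg_div_exp2 1)).
have sn0 : 0 <= s * 2 ^+ n by rewrite mulr_ge0// ltW.
have := truncn_itv sn0; set k := Num.truncn _ => /andP[ks sk].
have kt : k.+1%:R / 2 ^+ n < t.
  rewrite -[_.+1%:R]natr1 mulrDl; move: nst; rewrite ltrBrDl; apply: le_lt_trans.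
  by rewrite lerD2r ler_pdivrMr.
exists n, k.+1; split; last by rewrite ltr_pdivlMr// sk.
by rewrite -(ler_nat R) natrX -[leRHS]mul1r -ler_pdivrMr// (le_trans (ltW kt)).
Unshelve. all: by end_near. Qed.

Lemma scale_continuous x : q set0 < x < q setT -> scale y @[y --> x] --> scale x.
Proof.
move=> /andP[x0 xT]; have sx0 := scale_gt0 x0.
have sx1 : scale x < 1 by rewrite -scaleT scale_lt// ltW.
have scale_ltW y z : q set0 <= y -> scale z < scale y -> z < y.
  by move=> y0; apply: contraTT; rewrite -!leNgt; exact: scale_nd.
apply/cvgrPdist_lt => e e0.
have [n [k [kn /andP[lo_e lo_x]]]] : exists n k,
    (k <= 2 ^ n)%N /\ Num.max 0 (scale x - e) < k%:R / 2 ^+ n < scale x.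
  by apply: exists_dyadic_between; rewrite ?le_max ?lexx ?(ltW sx1)// gt_max sx0 gtrBl.
have [m [j [jm /andP[hi_x hi_e]]]] : exists m j,
    (j <= 2 ^ m)%N /\ scale x < j%:R / 2 ^+ m < Num.min 1 (scale x + e).
  by apply: exists_dyadic_between; rewrite ?(ltW sx0)// ?lt_min ?sx1 ?ltrDl// ge_min lexx.
rewrite -(scale_block kn) in lo_e lo_x; rewrite -(scale_block jm) in hi_x hi_e.
have [q0n _] := andP (qual_itv qualq (block_measurable n 0 k)).
have [q0m _] := andP (qual_itv qualq (block_measurable m 0 j)).
near=> y.
have yn : q (block n 0 k) < y.
  by near: y; apply: (cvgr_gt x cvg_id); exact: scale_ltW (ltW x0) lo_x.
have ym : y < q (block m 0 j).
  by near: y; apply: (cvgr_lt x cvg_id); exact: scale_ltW hi_x.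
have := scale_nd q0n (ltW yn); have := scale_nd (le_trans q0n (ltW yn)) (ltW ym).
move: lo_e hi_e; rewrite gt_max lt_min => /andP[_ lo_e] /andP[_ hi_e].
by rewrite ltr_distlC => *; apply/andP; split; lra.
Unshelve. all: by end_near. Qed.

(* The values of [psi] at the ends of the blocks are determined by additivity. *)
Lemma scale_unique (psi : R -> R) x :
  (forall y z, q set0 <= y -> y <= z -> z <= q setT -> psi y <= psi z) ->
  (forall S S', measurable S -> measurable S' -> S `&` S' = set0 ->
    psi (q (S `|` S')) = psi (q S) + psi (q S') - psi (q set0)) ->
  q set0 <= x <= q setT ->
  psi x = psi (q set0) + (psi (q setT) - psi (q set0)) * scale x.
Proof.
move=> psi_nd psi_add x0T; set a := psi (q set0); set w := psi (q setT) - a.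
have psi_block n k : (k <= 2 ^ n)%N ->
    psi (q (block n 0 k)) = a + k%:R * (psi (q (cell n 0)) - a).
  elim: k => [|k IH] kn; first by rewrite blocknn mul0r addr0.
  rewrite blockS psi_add//; last by rewrite -block1 block_disj.
  rewrite IH ?(ltnW kn)// (qual_cell naP qualq (k := 0) kn) ?expn_gt0//.
  by rewrite -natr1 /a; lra.
have psi_cell n : psi (q (cell n 0)) - a = w / 2 ^+ n.
  have := psi_block n _ (leqnn _); rewrite block_full// -natrX /w => ->.
  by rewrite [a + _]addrC addrK mulrAC divff ?mul1r// pnatr_eq0 expn_eq0.
have w0 : 0 <= w by rewrite subr_ge0 psi_nd// (qual_le qualq).
suff close n : a + w * scale x - w / 2 ^+ n <= psi x <= a + w * scale x + w / 2 ^+ n.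
  apply/eqP; rewrite eq_le; apply/andP; split.
    by apply: (@ler_addgt_div_exp2 _ w) => n; case/andP: (close n).
  by apply: (@ler_addgt_div_exp2 _ w) => n; rewrite -lerBlDr; case/andP: (close n).
have [k [kn /andP[k1 k2] /andP[k3 k4]]] := scale_bracket n x0T.
have /andP[x0 xT] := x0T.
have := psi_nd _ _ (qual_ge0 qualq (block_measurable n 0 k)) k1 xT.
have := psi_nd _ _ x0 k2.
move=> /(_ (qual_le qualq (block_measurable _ _ _) measurableT (@subsetT _ _))).
rewrite !psi_block ?(ltnW kn)// psi_cell.
have := ler_wpM2l w0 k3; have := ler_wpM2l w0 k4; rewrite -(natr1 k).
move: (2 ^+ n)^-1 (scale x) (psi x) (k%:R : R) => u s p c.
by move=> *; apply/andP; split; lra.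
Qed.

End scale.

(** * Preferences satisfying the sure-thing principle *)

Section preference.
Context {d : measure_display} {T : measurableType d} {R : realType}.
Variable P : probability T R.
Implicit Types (A S : set T) (X Y Z : T -> R).

Record preference (I : (T -> R) -> R) : Prop := Preference {
  pref_ae : forall X Y, Linf X -> Linf Y -> aeeq P X Y -> I X = I Y;
  pref_cvg : dominated_continuous P I;
  pref_lt : forall x y Z A, x < y -> Linf Z -> measurable A -> (0 < P A)%E ->
    I (patch Z A (cst x)) < I (patch Z A (cst y));
  pref_cst : forall c, I (cst c) = c;
  pref_sure_thing : forall A X X' Z Z', measurable A ->
    Linf X -> Linf X' -> Linf Z -> Linf Z' ->
    I (patch Z A X) <= I (patch Z A X') -> I (patch Z' A X) <= I (patch Z' A X') }.

Variable I : (T -> R) -> R.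
Hypothesis prefI : preference I.

Lemma pref_sure_thing_le A X X' Z Z' : measurable A ->
  Linf X -> Linf X' -> Linf Z -> Linf Z' ->
  (I (patch Z A X) <= I (patch Z A X')) = (I (patch Z' A X) <= I (patch Z' A X')).
Proof. by move=> *; apply/idP/idP; exact: (pref_sure_thing prefI). Qed.

Lemma pref_sure_thing_eq A X X' Z Z' : measurable A ->
  Linf X -> Linf X' -> Linf Z -> Linf Z' ->
  I (patch Z A X) = I (patch Z A X') -> I (patch Z' A X) = I (patch Z' A X').
Proof.
move=> mA LX LX' LZ LZ' /eqP; rewrite eq_le => /andP[XX' X'X].
by apply/eqP; rewrite eq_le -!(@pref_sure_thing_le _ _ _ Z) ?XX'.
Qed.

Lemma pref_patch_null A X Z : measurable A -> Linf X -> Linf Z -> P A = 0%E ->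
  I (patch Z A X) = I Z.
Proof.
move=> mA LX LZ A0; apply: (pref_ae prefI) => //; first exact: Linf_patch.
have := null_set_ae mA A0; apply: filterS => w nAw; exact: patch_out.
Qed.

Lemma pref_patch_cst_le x y Z A : x <= y -> Linf Z -> measurable A ->
  I (patch Z A (cst x)) <= I (patch Z A (cst y)).
Proof.
move=> xy LZ mA; have [A0|A0] := eqVneq (P A) 0%E.
  by rewrite !pref_patch_null.
move: xy; rewrite le_eqVlt => /predU1P[->//|xy].
by apply/ltW/(pref_lt prefI) => //; rewrite measure_gt0.
Qed.

(* [X] is turned into [Y] on the sets where [(X, Y)] is constant, one at a time. *)
Lemma pref_le_simple (s t : seq R) X Y : Linf X -> Linf Y -> (forall w, X w \in s) ->
  (forall w, Y w \in t) -> (forall w, X w <= Y w) -> I X <= I Y.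
Proof.
move=> LX LY Xs Yt XY; pose level (l : seq (R * R)) := [set w | (X w, Y w) \in l].
suff raise l : Linf (patch X (level l) Y) /\ I X <= I (patch X (level l) Y).
  have [_] := raise [seq (x, y) | x <- s, y <- t].
  rewrite (_ : level _ = setT) ?patch_setT//.
  by apply/seteqP; split=> // w _; rewrite /level /= allpairs_f.
elim: l => [|[x y] l [LW XW]].
  by rewrite (_ : level [::] = set0) ?patch_set0//; apply/seteqP; split.
pose C := [set w | X w = x] `&` [set w | Y w = y].
have mC : measurable C by apply: measurableI; exact: Linf_fiber.
have levelE : level ((x, y) :: l) = C `|` level l.
  apply/seteqP; split=> w; rewrite /level /C /= inE.
    by move=> /predU1P[[-> ->]|]; [left|right].
  by move=> [[-> ->]|->]; rewrite ?eqxx ?orbT.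
have CW : patch (patch X (level l) Y) C Y = patch (patch X (level l) Y) C (cst y).
  by apply: eq_patch => // w [].
have LW' : Linf (patch X (level ((x, y) :: l)) Y).
  by rewrite levelE patch_setU CW; exact: Linf_patch.
split=> //; apply: le_trans XW _; rewrite levelE patch_setU CW.
have [[w0 [/= Xw0 Yw0]]|/nonemptyPn->] := pselect (C !=set0); last first.
  by rewrite patch_set0.
have [xyl|xyl] := boolP ((x, y) \in l).
  rewrite [patch _ C _]patch_idr// => w [/= Xw Yw].
  by rewrite patch_in /level/= ?Xw ?Yw.
have {1}-> : patch X (level l) Y = patch (patch X (level l) Y) C (cst x).
  rewrite [RHS]patch_idr// => w [/= Xw Yw].
  by rewrite patch_out /level/= ?Xw ?Yw ?(negbTE xyl).
by apply: pref_patch_cst_le => //; rewrite -Xw0 -Yw0.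
Qed.

Lemma pref_le X Y : Linf X -> Linf Y -> (forall w, X w <= Y w) -> I X <= I Y.
Proof.
move=> LX LY XY; have [mX [M XM]] := LX; have [mY [N YN]] := LY.
have mD : G_meas Fsig (fun w => Y w - X w).
  by apply/(G_measE sub_sigmaF)/measurable_funB; exact/(G_measE sub_sigmaF).
have [w|S [mS Srange SM SX]] := simple_approximation sub_sigmaF (a := - M) (b := M) mX.
  by rewrite -ler_norml.
have [w|D [mDn Drange DM DYX]] :=
    simple_approximation sub_sigmaF (a := 0) (b := M + N) mD.
  rewrite subr_ge0 XY /= addrC lerD// ?(le_trans (ler_norm _) (YN w))//.
  by rewrite (le_trans (ler_norm _))// normrN.
have LS n : Linf (S n) by split=> //; exists M => w; rewrite ler_norml.
have SD_bound n w : `|(S n \+ D n) w| <= M + (M + N).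
  rewrite (le_trans (ler_normD _ _))// lerD// ler_norml//.
  by have /andP[D0 DMN] := DM n w; rewrite DMN (le_trans _ D0)// oppr_le0 (le_trans D0).
have LSD n : Linf (S n \+ D n).
  by split; [exact: (G_measD sub_sigmaF)|exists (M + (M + N)) => w; exact: SD_bound].
have SDY w : (S n \+ D n) w @[n --> \oo] --> Y w.
  by rewrite -[Y w](subrKC (X w)); exact: cvgD.
have IS : I (S n) @[n --> \oo] --> I X.
  apply: (pref_cvg prefI) => //; last exact: aeW.
  by exists M => n w; rewrite ler_norml.
have ISD : I (S n \+ D n) @[n --> \oo] --> I Y.
  apply: (pref_cvg prefI) => //; last exact: aeW.
  by exists (M + (M + N)) => n w; exact: SD_bound.
apply: (ler_cvg_to IS ISD); apply: nearW => n.
have [[s Ss] [t Dt]] := (Srange n, Drange n).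
apply: (@pref_le_simple s [seq x + y | x <- s, y <- t]) => // w; last first.
  by rewrite lerDl; case/andP: (DM n w).
exact: allpairs_f.
Qed.

End preference.

(** * Additive utilities *)

Section bets.
Context {d : measure_display} {T : measurableType d} {R : realType}.
Variable P : probability T R.
Hypothesis naP : nonatomic P.
Variable I : (T -> R) -> R.
Hypothesis prefI : preference P I.
Implicit Types (A S : set T) (X Y Z : T -> R) (psi : R -> R).

Definition bet (a b : R) S : T -> R := patch (cst a) S (cst b).

Definition bet_scale (a b : R) : R -> R := scale (fun S => I (bet a b S)).

Definition ranged (a b : R) X := Linf X /\ forall w, a <= X w <= b.

Record order_additive (a b : R) psi : Prop := OrderAdditive {
  order_additive_lt : forall x y, a <= x -> x < y -> y <= b -> psi x < psi y;
  order_additive_patch : forall A X X' Y Y', measurable A ->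
    ranged a b X -> ranged a b X' -> ranged a b Y -> ranged a b Y' ->
    psi (I (patch Y A X)) + psi (I (patch Y' A X')) =
    psi (I (patch Y' A X)) + psi (I (patch Y A X')) }.

Lemma order_additiveW a b a' b' psi : a <= a' -> b' <= b ->
  order_additive a b psi -> order_additive a' b' psi.
Proof.
move=> aa' b'b [psi_lt psi_patch].
have rangedW X : ranged a' b' X -> ranged a b X.
  by move=> [LX Xab]; split=> // w; have /andP[? ?] := Xab w; apply/andP; split; lra.
split=> [x y a'x xy yb'|A X X' Y Y' mA rX rX' rY rY'].
  by apply: psi_lt => //; lra.
by apply: psi_patch => //; exact: rangedW.
Qed.

Lemma ranged_cst a b c : a <= c <= b -> ranged a b (cst c).
Proof. by []. Qed.

Lemma ranged_patch a b A X Y : measurable A -> ranged a b X -> ranged a b Y ->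
  ranged a b (patch Y A X).
Proof.
move=> mA [LX Xab] [LY Yab]; split=> [|w]; first exact: Linf_patch.
by rewrite /patch; case: ifP.
Qed.

Lemma Linf_bet a b S : measurable S -> Linf (bet a b S).
Proof. by move=> mS; exact: Linf_patch. Qed.

Lemma pref_itv a b X : ranged a b X -> a <= I X <= b.
Proof.
move=> [LX Xab]; rewrite -{1}(pref_cst prefI a) -(pref_cst prefI b).
by apply/andP; split; apply: (pref_le prefI) => // w; case/andP: (Xab w).
Qed.

Section bets_itv.
Variables a b : R.
Hypothesis ab : a < b.
Local Notation bet := (bet a b).
Local Notation bet_scale := (bet_scale a b).

Lemma pref_bet0 : I (bet set0) = a.
Proof. by rewrite /bet patch_set0 (pref_cst prefI). Qed.

Lemma pref_betT : I (bet setT) = b.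
Proof. by rewrite /bet patch_setT (pref_cst prefI). Qed.

Lemma ranged_bet S : measurable S -> ranged a b (bet S).
Proof. by move=> mS; apply: ranged_patch => //; apply: ranged_cst; rewrite lexx ltW. Qed.

Lemma pref_bet_qualitative : qualitative_probability P (fun S => I (bet S)).
Proof.
split=> [|S mS S0|S S' C mS mS' mC SC S'C].
- by apply: dominated_continuous_patch => //; exact: (pref_cvg prefI).
- rewrite pref_bet0 -{1}(pref_cst prefI a) -(patch_id S (cst a)).
  exact: (pref_lt prefI).
have betC U : U `&` C = set0 -> bet U = patch (cst a) (~` C) (bet U).
  move=> UC; rewrite patch_setC patch_idr// => w Cw; rewrite /bet patch_out// => Uw.
  by have : (U `&` C) w by []; rewrite UC.
have betUC U : bet (U `|` C) = patch (cst b) (~` C) (bet U).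
  by rewrite patch_setC /bet setUC patch_setU.
have mCC : measurable (~` C) by exact: measurableC.
rewrite !betUC [in RHS](betC S)// [in RHS](betC S')//.
by apply: (pref_sure_thing_le prefI) => //; exact: Linf_bet.
Qed.

Lemma bet_patch A S X : S `<=` A -> (forall w, ~ A w -> X w = a) ->
  patch X A (bet S) = bet S.
Proof.
move=> SA Xa; rewrite -patch_setC patch_idr// => w nAw.
by rewrite Xa// /bet patch_out// => /SA.
Qed.

Lemma bet_setU A S S' : S `<=` A -> S' `<=` ~` A ->
  bet (S `|` S') = patch (bet S') A (bet S).
Proof.
move=> SA S'A; apply/funext => w; rewrite /bet patch_setU.
have [Aw|nAw] := pselect (A w).
  by rewrite [RHS]patch_in// /patch (@memNset _ S') // => /S'A.
by rewrite [LHS]patch_out => [|/SA//]; rewrite [RHS]patch_out.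
Qed.

(* On each side of [A] a ranged function is exchanged for a bet of the same value. *)
Lemma bet_scale_patch A X Y : measurable A -> ranged a b X -> ranged a b Y ->
  bet_scale (I (patch Y A X)) =
  bet_scale (I (patch (cst a) A X)) + bet_scale (I (patch (cst a) (~` A) Y)).
Proof.
move=> mA rX rY; have mAC : measurable (~` A) by exact: measurableC.
have equivalent_bet B Z : measurable B -> ranged a b Z ->
    exists S, [/\ measurable S, S `<=` B & I (bet S) = I (patch (cst a) B Z)].
  move=> mB rZ; apply: (qual_ivt naP pref_bet_qualitative) => //.
  have [LZ Zab] := rZ; rewrite pref_bet0; apply/andP; split.
    have ra : ranged a b (cst a) by apply: ranged_cst; rewrite lexx ltW.
    by case/andP: (pref_itv (ranged_patch mB rZ ra)).
  apply: (pref_le prefI) => [||w]; [exact: Linf_patch|exact: Linf_bet|].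
  by rewrite /bet /patch; case: ifP => // _; case/andP: (Zab w).
have [S [mS SA IS]] := equivalent_bet A X mA rX.
have [S' [mS' S'A IS']] := equivalent_bet (~` A) Y mAC rY.
have SS' : S `&` S' = set0 by rewrite -subset0 => w [/SA Aw /S'A].
have [[LX _] [LY _]] := (rX, rY).
have [LS LS'] := (Linf_bet a b mS, Linf_bet a b mS').
rewrite -IS -IS' /bet_scale -(scale_setU naP pref_bet_qualitative)// (bet_setU SA S'A).
congr (bet_scale _); transitivity (I (patch Y A (bet S))).
  apply: (pref_sure_thing_eq prefI (Z := cst a)) => //.
  by rewrite [patch _ _ (bet S)]bet_patch// IS.
rewrite -[patch Y A _]patch_setC -[patch (bet S') A _]patch_setC.
apply: (pref_sure_thing_eq prefI (Z := cst a)) => //.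
by rewrite [patch _ _ (bet S')]bet_patch// IS'.
Qed.

Lemma bet_scale_order_additive : order_additive a b bet_scale.
Proof.
split=> [x y ax xy yb|A X X' Y Y' mA rX rX' rY rY'].
  by apply: (scale_lt naP pref_bet_qualitative); rewrite ?pref_bet0 ?pref_betT.
rewrite (bet_scale_patch mA rX rY) (bet_scale_patch mA rX' rY').
by rewrite (bet_scale_patch mA rX rY') (bet_scale_patch mA rX' rY); lra.
Qed.

Lemma bet_scale_continuous x : a < x < b -> bet_scale y @[y --> x] --> bet_scale x.
Proof.
move=> axb; apply: (scale_continuous naP pref_bet_qualitative).
by rewrite pref_bet0 pref_betT.
Qed.

Lemma order_additive_affine psi x : order_additive a b psi -> a <= x <= b ->
  psi x = psi a + (psi b - psi a) * bet_scale x.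
Proof.
move=> [psi_lt psi_patch] axb.
have psi_nd y z : a <= y -> y <= z -> z <= b -> psi y <= psi z.
  by move=> ay; rewrite le_eqVlt => /predU1P[->//|yz] zb; apply/ltW/psi_lt.
have := scale_unique naP pref_bet_qualitative (psi := psi).
rewrite pref_bet0 pref_betT; apply=> // S S' mS mS' SS'.
have ra : ranged a b (cst a) by apply: ranged_cst; rewrite lexx ltW.
have rb : ranged a b (cst b) by apply: ranged_cst; rewrite lexx ltW.
have := psi_patch S (cst b) (cst a) (bet S') (cst a) mS rb ra (ranged_bet mS') ra.
rewrite patch_id (pref_cst prefI) -patch_setU -/(bet S) -/(bet (S `|` S')).
rewrite [patch (bet S') S _]patch_idr; last first.
  move=> w Sw; rewrite /bet patch_out// => S'w.
  by have : (S `&` S') w by []; rewrite SS'.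
by lra.
Qed.

End bets_itv.
End bets.

Section utility.
Context {d : measure_display} {T : measurableType d} {R : realType}.
Variable P : probability T R.
Hypothesis naP : nonatomic P.
Variable I : (T -> R) -> R.
Hypothesis prefI : preference P I.
Implicit Types (A : set T) (X Y : T -> R) (psi : R -> R).

Definition normalize psi (x : R) : R := (psi x - psi 0) / (psi 1 - psi 0).

Lemma normalize_order_additive a b psi x : a <= 0 -> 1 <= b -> a <= x <= b ->
  order_additive I a b psi -> normalize psi x = normalize (bet_scale I a b) x.
Proof.
move=> a0 b1 axb psiI; have ab : a < b by lra.
have affine y : a <= y <= b ->
    psi y - psi 0 = (psi b - psi a) * (bet_scale I a b y - bet_scale I a b 0).
  move=> yab; rewrite (order_additive_affine naP prefI ab psiI yab).
  by rewrite (order_additive_affine naP prefI ab psiI (x := 0)); [ring|apply/andP; lra].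
have psi_ab : psi b - psi a != 0 by rewrite subr_eq0 gt_eqF// (order_additive_lt psiI).
rewrite /normalize !affine//; last by apply/andP; lra.
by rewrite -mulf_div divff// mul1r.
Qed.

Local Notation bound M := (M.+1%:R : R).
Local Notation scale_upto M := (bet_scale I (- bound M) (bound M)).

Let bound_gt0 M : 0 < bound M. Proof. exact: ltr0Sn. Qed.

Let scale_upto_additive M : order_additive I (- bound M) (bound M) (scale_upto M).
Proof. by apply: (bet_scale_order_additive naP prefI); have := bound_gt0 M; lra. Qed.

Definition utility (x : R) : R := normalize (scale_upto (Num.truncn `|x|)) x.

(* Scales of growing intervals agree once normalised, by uniqueness. *)
Lemma utilityE M x : `|x| <= bound M -> utility x = normalize (scale_upto M) x.
Proof.
move=> xM; rewrite /utility.
have /andP[_ /ltW xm] := truncn_itv (normr_ge0 x); set m := Num.truncn _ in xm *.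
have normalizeW i j : (i <= j)%N -> `|x| <= bound i ->
    normalize (scale_upto j) x = normalize (scale_upto i) x.
  move=> ij; rewrite ler_norml => xi; have ijR : bound i <= bound j by rewrite ler_nat.
  apply: normalize_order_additive => //; first by rewrite ler1n.
  by apply: order_additiveW (scale_upto_additive j) => //; rewrite lerN2.
by have [/normalizeW->|/ltnW/normalizeW->] := leqP M m.
Qed.

Let lt_bound (x : R) : `|x| < bound (Num.truncn `|x|).
Proof. by case/andP: (truncn_itv (normr_ge0 x)). Qed.

Lemma utility0 : utility 0 = 0.
Proof. by rewrite /utility /normalize subrr mul0r. Qed.

Lemma utility_lt : {homo utility : x y / x < y}.
Proof.
move=> x y xy; have /ltW := lt_bound (Num.max `|x| `|y|).
rewrite ger0_norm ?le_max ?normr_ge0//; set M := Num.truncn _.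
rewrite ge_max => /andP[xM yM].
rewrite !(utilityE (M := M))// /normalize.
have [scale_lt _] := scale_upto_additive M.
have scale01 : scale_upto M 0 < scale_upto M 1.
  by apply: scale_lt; rewrite ?oppr_le0 ?ler1n.
rewrite ltr_pM2r ?invr_gt0 ?subr_gt0// ltrD2r; move: xM yM; rewrite !ler_norml.
by move=> /andP[xM _] /andP[_ yM]; exact: scale_lt.
Qed.

Lemma utility_continuous : continuous utility.
Proof.
move=> x; pose M := Num.truncn `|x|; have xM : `|x| < bound M := lt_bound x.
have scale_cvg : normalize (scale_upto M) y @[y --> x] --> normalize (scale_upto M) x.
  apply: cvgM (cvg_cst _); apply: cvgB (cvg_cst _).
  apply: (bet_scale_continuous naP prefI); last by rewrite -ltr_norml.
  by have := bound_gt0 M; lra.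
rewrite /continuous_at (utilityE (M := M) (ltW xM)).
apply: cvg_trans scale_cvg; apply: near_eq_cvg.
near=> y; rewrite (utilityE (M := M))// ltW//; near: y.
exact: (cvgr_norm_lt _ cvg_id).
Unshelve. all: by end_near. Qed.

Lemma utility_patch A X X' Y Y' : measurable A ->
  Linf X -> Linf X' -> Linf Y -> Linf Y' ->
  utility (I (patch Y A X)) + utility (I (patch Y' A X')) =
  utility (I (patch Y' A X)) + utility (I (patch Y A X')).
Proof.
move=> mA LX LX' LY LY'.
have [_ [K XK]] := LX; have [_ [K' X'K]] := LX'.
have [_ [N YN]] := LY; have [_ [N' Y'N]] := LY'.
pose L := Num.max (Num.max K K') (Num.max N N'); pose M := Num.truncn `|L|.
have ranged_le Z B : Linf Z -> (forall w, `|Z w| <= B) -> B <= L ->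
    ranged (- bound M) (bound M) Z.
  move=> LZ ZB BL; split=> // w; rewrite -ler_norml.
  by rewrite (le_trans (ZB w))// (le_trans BL)// (le_trans (ler_norm _))// ltW.
have rX : ranged (- bound M) (bound M) X.
  by apply: ranged_le XK _ => //; rewrite !le_max lexx.
have rX' : ranged (- bound M) (bound M) X'.
  by apply: ranged_le X'K _ => //; rewrite !le_max lexx ?orbT.
have rY : ranged (- bound M) (bound M) Y.
  by apply: ranged_le YN _ => //; rewrite !le_max lexx ?orbT.
have rY' : ranged (- bound M) (bound M) Y'.
  by apply: ranged_le Y'N _ => //; rewrite !le_max lexx ?orbT.
have utilityI Z : ranged (- bound M) (bound M) Z ->
    utility (I Z) = normalize (scale_upto M) (I Z).
  by move=> /(pref_itv prefI); rewrite -ler_norml => /utilityE.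
rewrite !utilityI; do ?exact: ranged_patch.
rewrite /normalize -!mulrDl; congr (_ / _).
by have := order_additive_patch (scale_upto_additive M) mA rX rX' rY rY'; lra.
Qed.

End utility.

Section additive_functional.
Context {d : measure_display} {T : measurableType d} {R : realType}.
Variable P : probability T R.

Record additive_functional (V : (T -> R) -> R) : Prop := AdditiveFunctional {
  addf_ae : forall f g, Linf f -> Linf g -> aeeq P f g -> V f = V g;
  addf_cvg : dominated_continuous P V;
  addf0 : V (cst 0) = 0;
  addf_restrict : forall A f, measurable A -> Linf f ->
    V f = V (f \_ A) + V (f \_ (~` A)) }.

Lemma exists_additive_functional (I : (T -> R) -> R) : nonatomic P -> preference P I ->
  exists2 phi : R -> R, {homo phi : x y / x < y} & additive_functional (phi \o I).
Proof.
move=> naP prefI; exists (utility I); first exact: (utility_lt naP prefI).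
split=> [f g Lf Lg fg|X f LX Lf bX Xf| |A f mA Lf] /=.
- by rewrite (pref_ae prefI Lf Lg fg).
- apply: (cvg_comp (I \o X) (utility I) (pref_cvg prefI LX Lf bX Xf)).
  exact: (utility_continuous naP prefI).
- by rewrite (pref_cst prefI) utility0.
- rewrite !restrictE patch_setC.
  have := utility_patch naP prefI mA Lf (Linf_cst 0) Lf (Linf_cst 0).
  by rewrite !patch_id (pref_cst prefI) utility0 => <-; rewrite addr0.
Qed.

End additive_functional.

(** * Densities on sub-sigma-algebras *)

Section density.
Context {d : measure_display} {T : measurableType d} {R : realType}.
Variable P : probability T R.
Variable G : set (set T).
Hypothesis sG : sub_sigma G.
Let TG := g_sigma_algebraType G.

Let coarsen (w : T) : TG := w.

Let coarsen_measurable : measurable_fun [set: T] coarsen.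
Proof.
move=> _ A; rewrite (sub_sigma_measurableE sG) setTI; exact: (sub_sigma_measurable sG).
Qed.

Let coarsen_mfun : {mfun T >-> TG} :=
  MeasurableFun.Pack
    (MeasurableFun.Class (isMeasurableFun.Build _ _ _ _ _ coarsen_measurable)).

Let PG : probability TG R := distribution P coarsen_mfun.

Let PG_integrable (h : TG -> R) : PG.-integrable setT (EFin \o h) ->
  P.-integrable setT (EFin \o (h : T -> R)).
Proof.
move=> /[dup] /measurable_int mh /integrableP[_ ih]; apply/integrableP; split.
  exact: measurableT_comp mh coarsen_measurable.
by move: ih; rewrite ge0_integral_pushforward// ?preimage_setT//; exact: measurableT_comp.
Qed.

Let PG_integral A (h : TG -> R) : G A -> PG.-integrable setT (EFin \o h) ->
  (\int[PG]_(w in A) (h w)%:E = \int[P]_(w in (A : set T)) (h w)%:E)%E.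
Proof.
move=> GA ih; rewrite integral_pushforward// ?(sub_sigma_measurableE sG)//.
  exact: measurable_int ih.
by apply: integrableS (PG_integrable ih) => //; exact: (sub_sigma_measurable sG).
Qed.

Lemma exists_density (nu : set T -> R) : nu set0 = 0 ->
  (forall F : nat -> set T, (forall i, G (F i)) -> trivIset setT F ->
     \sum_(0 <= i < n) nu (F i) @[n --> \oo] --> nu (\bigcup_i F i)) ->
  (forall A, G A -> P A = 0%E -> nu A = 0) ->
  exists h : T -> R, [/\ G_meas G h, P.-integrable setT (EFin \o h) &
    forall A, G A -> \int[P]_(w in A) h w = nu A].
Proof.
move=> nu0 nu_sigma nu_ac; pose nuE (A : set TG) : \bar R := (nu A)%:E.
have nuE0 : nuE set0 = 0%E by rewrite /nuE nu0.
have nuE_fin A : measurable A -> nuE A \is a fin_num by [].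
have nuE_sigma : semi_sigma_additive nuE.
  move=> F; rewrite (sub_sigma_measurableE sG) => GF tF _.
  under eq_fun do rewrite sumEFin.
  by apply/fine_cvgP; split; [exact: nearW|exact: nu_sigma].
pose nuC : {charge set TG -> \bar R} :=
  HB.pack nuE (isCharge.Build _ TG R nuE nuE0 nuE_fin nuE_sigma).
have nuC_ac : nuC `<< PG.
  apply/null_content_dominatesP => A; rewrite (sub_sigma_measurableE sG) => GA PA0.
  by rewrite /nuC /= /nuE nu_ac.
pose h (w : TG) := fine (Radon_Nikodym nuC PG w).
have hE : Radon_Nikodym nuC PG = EFin \o h.
  by apply/funext => w; rewrite /h /= fineK// Radon_Nikodym_fin_num.
have ih : PG.-integrable setT (EFin \o h) by rewrite -hE; exact: Radon_Nikodym_integrable.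
exists h; split=> [||A GA]; last 1 first.
- have mA : measurable (A : set TG) by rewrite (sub_sigma_measurableE sG).
  rewrite /Rintegral -PG_integral//.
  by have := Radon_Nikodym_integral nuC_ac mA; rewrite hE => <-.
- by apply/(G_measE sG)/measurable_EFinP; exact: measurable_int ih.
- exact: PG_integrable.
Qed.

End density.

Section conditional_expectation.
Context {d : measure_display} {T : measurableType d} {R : realType}.
Variable P : probability T R.
Implicit Types (A : set T) (h k : T -> R).

Lemma Rintegral_gt0 A h : measurable A -> P.-integrable A (EFin \o h) ->
  (forall w, A w -> 0 < h w) -> (0 < P A)%E -> 0 < \int[P]_(w in A) h w.
Proof.
move=> mA ih h0 A0; rewrite lt_neqAle Rintegral_ge0 ?andbT => [|w /h0/ltW//].
apply/eqP => int0.
have : (\int[P]_(w in A) `|(EFin \o h) w| = 0)%E.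
  rewrite (eq_integral (EFin \o h)) => [|w /set_mem/h0 hw]; last by rewrite /= gtr0_norm.
  by rewrite -[LHS]fineK ?integrable_fin_num// -[fine _]int0.
move=> /(ae_eq_integral_abs P mA (measurable_int P ih))[N [mN N0 AN]].
have AsubN : A `<=` N.
  by move=> w Aw; apply: AN => /= /(_ Aw)[]; apply/eqP; rewrite gt_eqF ?h0.
by move: A0; rewrite lt_neqAle eq_sym (subset_measure0 mA mN AsubN N0) eqxx.
Qed.

Lemma lt_Rintegral A h k : measurable A ->
  P.-integrable A (EFin \o h) -> P.-integrable A (EFin \o k) ->
  (forall w, A w -> h w < k w) -> (0 < P A)%E ->
  \int[P]_(w in A) h w < \int[P]_(w in A) k w.
Proof.
move=> mA ih ik hk A0; rewrite -subr_gt0 -RintegralB//; apply: Rintegral_gt0 => //.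
  exact: (integrableB mA ik ih).
by move=> w Aw; rewrite subr_gt0 hk.
Qed.

Lemma Rintegral_EFin A h k : measurable A ->
  P.-integrable A (EFin \o h) -> P.-integrable A (EFin \o k) ->
  \int[P]_(w in A) h w = \int[P]_(w in A) k w ->
  (\int[P]_(w in A) (h w)%:E = \int[P]_(w in A) (k w)%:E)%E.
Proof.
move=> mA ih ik hk; rewrite -[LHS]fineK ?integrable_fin_num//.
by rewrite -[RHS]fineK ?integrable_fin_num//; congr (_%:E).
Qed.

Lemma ae_eq_Rintegral A h k : measurable A -> measurable_fun A h -> measurable_fun A k ->
  aeeq P h k -> \int[P]_(w in A) h w = \int[P]_(w in A) k w.
Proof.
move=> mA mh mk hk; congr fine.
apply: ae_eq_integral => //; [exact/measurable_EFinP..|].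
by apply: filterS hk => w /= -> _.
Qed.

Variable G : set (set T).
Hypothesis sG : sub_sigma G.

Lemma ae_le_Rintegral h k : G_meas G h -> G_meas G k ->
  P.-integrable setT (EFin \o h) -> P.-integrable setT (EFin \o k) ->
  (forall A, G A -> \int[P]_(w in A) h w <= \int[P]_(w in A) k w) ->
  {ae P, forall w, h w <= k w}.
Proof.
move=> mh mk ih ik hk; pose A := [set w | k w < h w].
have GA : G A by exact: G_meas_lt.
have mA := sub_sigma_measurable sG GA.
exists A; split=> //; last by move=> w /= /negP; rewrite -ltNge.
apply: contrapT => /eqP; rewrite -measure_gt0 => A0.
have := hk A GA; rewrite leNgt => /negP; apply.
by apply: lt_Rintegral => //; exact: (integrableS measurableT).
Qed.

Lemma ae_lt_Rintegral h k : G_meas G h -> G_meas G k ->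
  P.-integrable setT (EFin \o h) -> P.-integrable setT (EFin \o k) ->
  (forall A, G A -> (0 < P A)%E -> \int[P]_(w in A) h w < \int[P]_(w in A) k w) ->
  {ae P, forall w, h w < k w}.
Proof.
move=> mh mk ih ik hk; pose A := [set w | k w <= h w].
have GA : G A by exact: G_meas_le.
have mA := sub_sigma_measurable sG GA.
exists A; split=> //; last by move=> w /= /negP; rewrite -leNgt.
apply: contrapT => /eqP; rewrite -measure_gt0 => /(hk _ GA).
rewrite ltNge => /negP; apply.
by apply: le_Rintegral => //; exact: (integrableS measurableT).
Qed.

Lemma ae_eq_condexp h k : G_meas G h -> G_meas G k ->
  P.-integrable setT (EFin \o h) -> P.-integrable setT (EFin \o k) ->
  (forall A, G A -> \int[P]_(w in A) h w = \int[P]_(w in A) k w) -> aeeq P h k.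
Proof.
move=> mh mk ih ik hk.
have hk_le : {ae P, forall w, h w <= k w} by apply: ae_le_Rintegral => // A /hk->.
have kh_le : {ae P, forall w, k w <= h w} by apply: ae_le_Rintegral => // A /hk->.
by apply: filterS2 hk_le kh_le => w hkw khw; apply/eqP; rewrite eq_le hkw khw.
Qed.

End conditional_expectation.

(** * Regular integrands *)

Section regular.
Context {d : measure_display} {T : measurableType d} {R : realType}.
Implicit Types (phi : T -> R -> R).
Variable G : set (set T).
Hypothesis sG : sub_sigma G.

Section regular_theory.
Variable phi : T -> R -> R.
Hypothesis rphi : regular G phi.

Lemma regularW : regular Fsig phi.
Proof.
have [cphi phi_lt phi0 mphi] := rphi; split=> // B /mphi.
apply: smallest_sub; first exact: smallest_sigma_algebra.
move=> _ [A [C [GA mC ->]]]; apply: sub_sigma_algebra; exists A, C; split=> //.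
exact: sub_sigma_measurable GA.
Qed.

Lemma regular0 w : phi w 0 = 0. Proof. by case: rphi. Qed.

Lemma regular_continuous w : continuous (phi w). Proof. by case: rphi. Qed.

Lemma regular_lt w x y : x < y -> phi w x < phi w y.
Proof. by case: rphi => _ + _ _; apply. Qed.

Lemma regular_le w : {mono phi w : x y / x <= y}.
Proof. by apply: le_mono => x y; exact: regular_lt. Qed.

Lemma regular_inj w : injective (phi w). Proof. exact: inc_inj (regular_le w). Qed.

Lemma regular_norm_le w x a b : a <= x <= b -> `|phi w x| <= `|phi w a| + `|phi w b|.
Proof.
move=> /andP[]; rewrite -(regular_le w) => ax; rewrite -(regular_le w) ler_norml => xb.
have := ler_norm (phi w b); have := ler_norm (- phi w a); rewrite normrN.
by have := normr_ge0 (phi w a); have := normr_ge0 (phi w b); lra.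
Qed.

Lemma Phi_regular w y : Phi phi w (phi w y) = y.
Proof.
rewrite /Phi (_ : [set _ | _] = `]y, +oo[%classic); first exact: inf_itv.
by apply/seteqP; split=> z; rewrite /= in_itv/= andbT (leW_mono (regular_le w)).
Qed.

Lemma regular_G_meas g : G_meas G g -> G_meas G (fun w => phi w (g w)).
Proof.
move=> mg B mB; have [_ _ _ /(_ B mB)] := rphi.
pose graph_preimage := [set S : set (T * R) | G ((fun w => (w, g w)) @^-1` S)].
suff : prod_sigma G `<=` graph_preimage by apply.
apply: smallest_sub; last first.
  move=> _ [A [C [GA mC ->]]]; rewrite /graph_preimage /=.
  by apply: (sub_sigmaI sG GA (B := g @^-1` C)); exact: mg.
split=> [|S GS|F GF]; rewrite /graph_preimage /=.
- by rewrite preimage_set0; exact: sub_sigma0.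
- by rewrite setTD; exact: sub_sigmaC.
- by rewrite preimage_bigcup; exact: sub_sigma_bigcup.
Qed.

End regular_theory.

(* [phi w x > c] if and only if [phi w q > c] for some rational [q < x]. *)
Lemma prod_sigma_measurable phi : (forall w, continuous (phi w)) ->
  (forall w x y, x < y -> phi w x < phi w y) ->
  (forall q : rat, G_meas G (fun w => phi w (ratr q))) ->
  forall B : set R, measurable B -> prod_sigma G ((fun p : T * R => phi p.1 p.2) @^-1` B).
Proof.
move=> cphi phi_lt mphi B; pose phi2 (p : T * R) := phi p.1 p.2.
have [s0 sC sU] : sigma_algebra setT (@prod_sigma d T R G).
  exact: smallest_sigma_algebra.
change (measurable B) with ((@ocitv R).-sigma.-measurable B).
rewrite RGenOInfty.measurableE.
suff : <<s @RGenOInfty.G R>> `<=` [set B | prod_sigma G (phi2 @^-1` B)] by apply.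
apply: smallest_sub.
  split=> [|A mA|F mF] /=; first by rewrite preimage_set0.
    by rewrite setTD preimage_setC -setTD; exact: sC.
  by rewrite preimage_bigcup; exact: sU.
move=> _ [c ->] /=.
pose D (n : nat) : set (T * R) := if unpickle n is Some q then
  [set w | c < phi w (ratr q)] `*` `]ratr q, +oo[%classic else set0.
rewrite (_ : _ @^-1` _ = \bigcup_n D n).
  apply: sU => n; rewrite /D; case: (unpickle n) => [q|//].
  apply: sub_sigma_algebra; exists [set w | c < phi w (ratr q)], `]ratr q, +oo[%classic.
  by split=> //; apply: (G_meas_lt sG) => //; exact: (G_meas_cst sG).
apply/seteqP; split=> [[w x]|[w x] [n _]] /=; rewrite in_itv/= andbT.
  move=> cx; near x^'- => y; have yx : y < x by near: y; exact: nbhs_left_lt.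
  have cy : c < phi w y.
    by near: y; apply: cvg_at_left_filter (cvgr_gt _ (cphi w x) _ cx); exact: cvg_id.
  have [q] := rat_in_itvoo yx; rewrite in_itv/= => /andP[yq qx].
  exists (pickle q); first exact: I.
  rewrite /D pickleK; split=> /=; last by rewrite in_itv/= qx.
  exact: lt_trans cy (phi_lt w _ _ yq).
rewrite /D; case: (unpickle n) => [q|//] [/= cq]; rewrite in_itv/= andbT => qx.
exact: lt_trans cq (phi_lt w _ _ qx).
Unshelve. all: by end_near. Qed.

End regular.

Section expected_utility.
Context {d : measure_display} {T : measurableType d} {R : realType}.
Variables (P : probability T R) (phi : T -> R -> R).
Hypothesis rphi : regular (@Fsig d T) phi.
Hypothesis iphi : forall x, P.-integrable setT (fun w => (phi w x)%:E).
Implicit Types (A : set T) (f g : T -> R).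

Definition expected_utility f : R := \int[P]_w phi w (f w).

Let norm_phi_le f M w : (forall w, `|f w| <= M) ->
  `|phi w (f w)| <= `|phi w (- M)| + `|phi w M|.
Proof. by move=> fM; apply: (regular_norm_le rphi); rewrite -ler_norml. Qed.

Let dominator_integrable M :
  P.-integrable setT (fun w => (`|phi w (- M)| + `|phi w M|)%:E).
Proof.
have := integrableD measurableT (integrable_abse (iphi (- M))) (integrable_abse (iphi M)).
by apply: eq_integrable.
Qed.

Lemma regular_measurable A f : Linf f -> measurable_fun A (fun w => phi w (f w)).
Proof.
move=> [mf _]; apply: measurable_funTS; apply: (G_meas_measurable sub_sigmaF).
exact: (regular_G_meas sub_sigmaF rphi).
Qed.

Lemma regular_integrable A f : Linf f -> measurable A ->
  P.-integrable A (fun w => (phi w (f w))%:E).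
Proof.
move=> Lf mA; have [_ [M fM]] := Lf; apply: (integrableS measurableT) => //.
apply: le_integrable (dominator_integrable M) => //.
  by apply/measurable_EFinP; exact: regular_measurable.
move=> w _; rewrite /= lee_fin [leRHS]ger0_norm ?addr_ge0//; exact: norm_phi_le.
Qed.

Lemma expected_utility_restrict A f : measurable A ->
  expected_utility (f \_ A) = \int[P]_(w in A) phi w (f w).
Proof.
move=> mA; rewrite [RHS]Rintegral_mkcond; apply: eq_Rintegral => w _.
by rewrite /patch; case: ifP => // _; exact: (regular0 rphi).
Qed.

Lemma expected_utility_ae f g : Linf f -> Linf g -> aeeq P f g ->
  expected_utility f = expected_utility g.
Proof.
move=> Lf Lg fg; apply: ae_eq_Rintegral => //; [exact: regular_measurable..|].
by apply: filterS fg => w ->.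
Qed.

Lemma expected_utility_dominated : dominated_continuous P expected_utility.
Proof.
move=> X f LX Lf [M XM] Xf; rewrite /expected_utility /Rintegral.
apply: fine_cvg; rewrite fineK ?integrable_fin_num ?regular_integrable//.
have [|||| _ _] := @dominated_convergence _ T R P setT measurableT
  (fun n w => (phi w (X n w))%:E) (fun w => (phi w (f w))%:E) _ _ _ _
  (dominator_integrable M).
- by move=> n; apply/measurable_EFinP; exact: regular_measurable.
- by apply/measurable_EFinP; exact: regular_measurable.
- apply: filterS Xf => w Xw _; apply/fine_cvgP; split; first exact: nearW.
  exact: (cvg_comp _ _ Xw (regular_continuous rphi (x := f w))).
- by apply: aeW => w n _; rewrite lee_fin; exact: norm_phi_le.
exact.
Qed.

Lemma expected_utility_additive : additive_functional P expected_utility.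
Proof.
split=> [f g||| A f mA Lf].
- exact: expected_utility_ae.
- exact: expected_utility_dominated.
- rewrite /expected_utility (_ : (fun w => _) = cst 0) ?Rintegral_cst ?mul0r//.
  by apply/funext => w; exact: (regular0 rphi).
- have mAC : measurable (~` A) by exact: measurableC.
  rewrite !expected_utility_restrict// -Rintegral_setU// ?setUv//.
    exact: regular_integrable.
  by apply/disj_setPS; rewrite setICr.
Qed.

End expected_utility.

Section additive_functional_theory.
Context {d : measure_display} {T : measurableType d} {R : realType}.
Variable P : probability T R.
Variable V : (T -> R) -> R.
Hypothesis addV : additive_functional P V.
Implicit Types (A B : set T) (f : T -> R).

Lemma addf_setU A B f : measurable A -> measurable B -> A `&` B = set0 -> Linf f ->
  V (f \_ (A `|` B)) = V (f \_ A) + V (f \_ B).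
Proof.
move=> mA mB AB Lf; rewrite (addf_restrict addV mA); last first.
  by apply: Linf_restrict => //; exact: measurableU.
rewrite -!patch_setI; congr (V (f \_ _) + V (f \_ _)).
  by rewrite setIC setUK.
by rewrite setIUr setICl set0U; apply/setIidPr; rewrite -disjoints_subset setIC.
Qed.

Lemma addf_set0 f : V (f \_ set0) = 0.
Proof. by rewrite restrict_set0 (addf0 addV). Qed.

Lemma addf_set_continuous f : Linf f -> set_continuous P (fun A => V (f \_ A)).
Proof.
move=> Lf; exact: (dominated_continuous_patch (addf_cvg addV) Lf (Linf_cst 0)).
Qed.

Lemma addf_sigma_additive f (F : (set T)^nat) : Linf f -> (forall i, measurable (F i)) ->
  trivIset setT F ->
  \sum_(0 <= i < n) V (f \_ (F i)) @[n --> \oo] --> V (f \_ (\bigcup_i F i)).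
Proof.
move=> Lf mF tF; pose U n := \big[setU/set0]_(i < n) F i.
have mU n : measurable (U n) by exact: bigsetU_measurable.
have -> : (fun n => \sum_(0 <= i < n) V (f \_ (F i))) = (fun n => V (f \_ (U n))).
  apply/funext; elim=> [|n IH]; first by rewrite /U big_geq// big_ord0 addf_set0.
  rewrite big_nat_recr//= IH [U n.+1]big_ord_recr/= addf_setU//; first exact: mU.
  by apply: (@trivIset_bigsetUI _ predT) => //; rewrite /predT /= trueE.
have -> : \bigcup_i F i = \bigcup_n U n.
  rewrite -bigcup_bigsetU_bigcup; apply/seteqP.
  by split=> w [n _ Uw]; [exists n.+1|exists n => //; exact: subset_bigsetU Uw].
apply: (set_continuous_bigcup (addf_set_continuous Lf) mU).
by move=> m n mn; apply/subsetPset; exact: subset_bigsetU.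
Qed.

Lemma addf_restrict_cst_cvg (x : nat -> R) l (M : R) A :
  measurable A -> (forall n, `|x n| <= M) ->
  x n @[n --> \oo] --> l -> V (cst (x n) \_ A) @[n --> \oo] --> V (cst l \_ A).
Proof.
move=> mA xM xl; apply: (addf_cvg addV) => [n|||].
- exact: Linf_restrict.
- exact: Linf_restrict.
- by exists (Num.max M 0) => n w; rewrite restrictE norm_patch_le ?xM//= normr0.
- by apply: aeW => w; apply: cvg_patch; [exact: xl|exact: cvg_cst].
Qed.

Variable G : set (set T).
Hypothesis sG : sub_sigma G.

Lemma exists_addf_density x : exists h : T -> R,
  [/\ G_meas G h, P.-integrable setT (EFin \o h) &
   forall A, G A -> \int[P]_(w in A) h w = V (cst x \_ A)].
Proof.
apply: (@exists_density _ _ _ P G sG (fun A => V (cst x \_ A))); first exact: addf_set0.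
  by move=> F GF tF; apply: addf_sigma_additive => // i; exact: (sub_sigma_measurable sG).
move=> A /(sub_sigma_measurable sG) mA A0; rewrite -(addf_set0 (cst x)).
apply: (set_continuous_ae (addf_set_continuous (Linf_cst x))) => //.
by apply: filterS (null_set_ae mA A0).
Qed.

End additive_functional_theory.

Lemma exists_rat_approx {R : realType} (x : R) : exists q : nat -> rat,
  (forall n, x <= ratr (q n) <= x + 1) /\ ratr (q n) @[n --> \oo] --> x.
Proof.
have /choice[q qP] n : exists q : rat, x < ratr q < x + n.+1%:R^-1.
  have xn : x < x + n.+1%:R^-1 by rewrite ltrDl invr_gt0.
  by have [q] := rat_in_itvoo xn; exists q.
exists q; split=> [n|].
  have /andP[/ltW-> /ltW/le_trans->]//= := qP n.
  by rewrite lerD2l invf_le1 ?ler1n.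
apply: (@squeeze_cvgr _ _ _ _ (cst x) (fun n => x + harmonic n)).
- by apply: nearW => n; have /andP[/ltW-> /ltW->] := qP n.
- exact: cvg_cst.
- by rewrite -[X in _ --> X]addr0; apply: cvgD; [exact: cvg_cst|exact: cvg_harmonic].
Qed.

Section additive_functional_eq.
Context {d : measure_display} {T : measurableType d} {R : realType}.
Variable P : probability T R.
Variables V W : (T -> R) -> R.
Hypotheses (addV : additive_functional P V) (addW : additive_functional P W).
Variable G : set (set T).
Hypothesis sG : sub_sigma G.
Hypothesis VW_rat : forall (q : rat) A, G A ->
  V (cst (ratr q : R) \_ A) = W (cst (ratr q : R) \_ A).
Implicit Types (A : set T) (f : T -> R).

Lemma addf_eq_restrict_cst x A : G A -> V (cst x \_ A) = W (cst x \_ A).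
Proof.
move=> GA; have mA := sub_sigma_measurable sG GA.
have [q [qx qcvg]] := exists_rat_approx x.
have qM n : `|ratr (q n)| <= `|x| + 1 :> R.
  have /andP[xq qx1] := qx n; rewrite ler_norml.
  by have := ler_norm x; have := ler_norm (- x); rewrite normrN; lra.
have Vcvg := addf_restrict_cst_cvg addV mA qM qcvg.
have Wcvg : V (cst (ratr (q n) : R) \_ A) @[n --> \oo] --> W (cst x \_ A).
  by under eq_fun do rewrite VW_rat//; exact: (addf_restrict_cst_cvg addW mA qM).
exact: cvg_unique Vcvg Wcvg.
Qed.

Lemma addf_eq_simple (s : seq R) f :
  Linf_rep G f -> (forall w, f w \in 0 :: s) -> V f = W f.
Proof.
elim: s f => [|x s IH] f Gf fs.
  have -> : f = cst 0 by apply/funext => w; have := fs w; rewrite inE => /eqP.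
  by rewrite (addf0 addV) (addf0 addW).
pose A := [set w | f w = x]; have GA : G A by case: Gf => mf _; exact: G_meas_fiber.
have [mA Lf] := (sub_sigma_measurable sG GA, Linf_repW sG Gf).
rewrite (addf_restrict addV mA Lf) (addf_restrict addW mA Lf); congr (_ + _).
  have -> : f \_ A = cst x \_ A by exact: eq_patch.
  exact: addf_eq_restrict_cst.
apply: IH => [|w]; first by apply: (Linf_rep_restrict sG) => //; exact: sub_sigmaC.
rewrite restrictE patch_setC; have [fx|fx] := pselect (A w).
  by rewrite patch_in ?mem_head.
by rewrite patch_out//; have := fs w; rewrite !inE => /or3P[->//|/eqP//|->]; rewrite orbT.
Qed.

Lemma addf_eq f : Linf_rep G f -> V f = W f.
Proof.
move=> Gf; have [mf [M fM]] := Gf.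
have [w|g [mg g_range gM gf]] := simple_approximation sG (a := - M) (b := M) mf.
  by rewrite -ler_norml.
have Gg n : Linf_rep G (g n) by split=> //; exists M => w; rewrite ler_norml.
have g_bounded : exists M, forall n w, `|g n w| <= M.
  by exists M => n w; rewrite ler_norml.
have VWg n : V (g n) = W (g n).
  by have [s gs] := g_range n; apply: (@addf_eq_simple s) => // w; rewrite inE gs orbT.
have Lg n := Linf_repW sG (Gg n); have Lf := Linf_repW sG Gf.
have Vcvg := addf_cvg addV Lg Lf g_bounded (aeW _ gf).
have Wcvg : V (g n) @[n --> \oo] --> W f.
  by under eq_fun do rewrite VWg; exact: (addf_cvg addW Lg Lf g_bounded (aeW _ gf)).
exact: cvg_unique Vcvg Wcvg.
Qed.

End additive_functional_eq.

(** * Regular versions of the densities *)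

Section dyadic_grid.
Context {R : realType}.

(* The points of mesh [2 ^- n] in [[- M, +oo[] *)
Definition dyad (M n i : nat) : R := i%:R / 2 ^+ n - M%:R.

Definition grid_size (M n : nat) : nat := (2 * M * 2 ^ n)%N.

Let exp2_gt0 n : 0 < 2 ^+ n :> R. Proof. exact: exprn_gt0. Qed.
Local Hint Resolve exp2_gt0 : core.

Lemma dyad_ratr M n i : dyad M n i = ratr (i%:R / 2 ^+ n - M%:R).
Proof. by rewrite /dyad rmorphB /= fmorph_div rmorphXn /= !ratr_nat. Qed.

Lemma dyad_le M n i j : (dyad M n i <= dyad M n j) = (i <= j)%N.
Proof. by rewrite lerD2r ler_pM2r ?invr_gt0// ler_nat. Qed.

Lemma dyadD M n i j : dyad M n (i + j) = dyad M n i + j%:R / 2 ^+ n.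
Proof. by rewrite /dyad natrD mulrDl addrAC. Qed.

Lemma dyad_double M n i : dyad M n.+1 i.*2 = dyad M n i.
Proof. by rewrite /dyad -muln2 natrM exprSr -mulf_div divff// mulr1. Qed.

Lemma dyad_half_le M n j : dyad M n j./2 <= dyad M n.+1 j.
Proof. by rewrite -dyad_double dyad_le -{2}(odd_double_half j) leq_addl. Qed.

Lemma dyad_half_ge M n j : dyad M n.+1 (j + 2) <= dyad M n (j./2 + 2).
Proof.
rewrite -[dyad M n _]dyad_double dyad_le doubleD -{1}(odd_double_half j) addnAC addnC.
by rewrite leq_add2l; case: (odd j).
Qed.

Lemma dyad_norm_le M n i : (i <= grid_size M n)%N -> `|dyad M n i| <= M%:R.
Proof.
move=> iM; rewrite /dyad ler_norml lerBrDr addNr divr_ge0 ?exprn_ge0//= lerBlDr.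
by rewrite ler_pdivrMr// -natrD -natrX -natrM ler_nat addnn -mul2n.
Qed.

Lemma dyad_bracket M n x : - M%:R + 1 <= x < M%:R ->
  exists2 i, (i < grid_size M n)%N & dyad M n i < x < dyad M n (i + 2).
Proof.
move=> /andP[Mx xM]; pose t := Num.truncn ((x + M%:R) * 2 ^+ n).
have x1 : 1 <= (x + M%:R) * 2 ^+ n.
  by rewrite -[1]mulr1 ler_pM// ?exprn_ege1 ?ler1n//; lra.
have /andP[tx xt] : t%:R <= (x + M%:R) * 2 ^+ n < t.+1%:R.
  by apply: truncn_itv; exact: le_trans x1.
have t0 : (0 < t)%N by rewrite -ltnS -(ltr_nat R); exact: le_lt_trans x1 xt.
exists t.-1.
  rewrite prednK// -(ler_nat R) (le_trans tx)// /grid_size !natrM natrX ler_pM2r//; lra.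
rewrite addn2 prednK// /dyad ltrBlDr ltr_pdivrMr// ltrBrDr ltr_pdivlMr// xt andbT.
by apply: lt_le_trans tx; rewrite ltr_nat prednK.
Qed.

End dyadic_grid.

Section oscillation.
Context {d : measure_display} {T : measurableType d} {R : realType}.
Variable P : probability T R.
Variable V : (T -> R) -> R.
Hypothesis addV : additive_functional P V.
Variable G : set (set T).
Hypothesis sG : sub_sigma G.
Variable r : R -> T -> R.
Hypothesis r_density : forall x, [/\ G_meas G (r x), P.-integrable setT (EFin \o r x) &
   forall A, G A -> \int[P]_(w in A) r x w = V (cst x \_ A)].
Implicit Types (A B : set T).

Let r_meas x : G_meas G (r x). Proof. by case: (r_density x). Qed.
Let r_integrable x : P.-integrable setT (EFin \o r x). Proof. by case: (r_density x). Qed.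
Let r_integral x A : G A -> \int[P]_(w in A) r x w = V (cst x \_ A).
Proof. by case: (r_density x) => _ _; exact. Qed.

Lemma addf_cst_gap (e x y : R) B : G B -> (forall w, B w -> e + r x w <= r y w) ->
  V (cst x \_ B) + e * fine (P B) <= V (cst y \_ B).
Proof.
move=> GB gap; have mB := sub_sigma_measurable sG GB.
have [ix iy] : P.-integrable B (EFin \o r x) /\ P.-integrable B (EFin \o r y).
  by split; apply: integrableS (r_integrable _).
rewrite -!r_integral// -lerBrDl -RintegralB// -Rintegral_cst//; apply: le_Rintegral => //.
- exact: finite_measure_integrable_cst.
- exact: (integrableB mB iy ix).
- by move=> w /gap; rewrite lerBrDr.
Qed.

Lemma addf_gap (e : R) (x y : nat -> R) (k : T -> nat) K B :
  (forall i, G [set w | k w = i]) -> G B -> Linf (x \o k) -> Linf (y \o k) ->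
  (forall w, B w -> (k w < K)%N /\ e + r (x (k w)) w <= r (y (k w)) w) ->
  V ((x \o k) \_ B) + e * fine (P B) <= V ((y \o k) \_ B).
Proof.
move=> Gk GB Lx Ly; elim: K B GB => [|K IH] B GB Bk.
  have -> : B = set0 by rewrite -subset0 => w /Bk[].
  by rewrite !(addf_set0 addV) measure0 mulr0 addr0.
pose A := [set w | k w = K]; have GA : G A by exact: Gk.
have [GI GD] := (sub_sigmaI sG GB GA, sub_sigmaD sG GB GA).
have [mI mD] := (sub_sigma_measurable sG GI, sub_sigma_measurable sG GD).
have ID : (B `&` A) `&` (B `\` A) = set0 by rewrite -setIA setDIK setI0.
have gapI :
    V ((x \o k) \_ (B `&` A)) + e * fine (P (B `&` A)) <= V ((y \o k) \_ (B `&` A)).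
  have kK (z : nat -> R) : (z \o k) \_ (B `&` A) = cst (z K) \_ (B `&` A).
    by apply: eq_patch => // w [_ /= ->].
  by rewrite !kK; apply: addf_cst_gap => // w [/Bk[_ +] kw]; rewrite kw.
have gapD :
    V ((x \o k) \_ (B `\` A)) + e * fine (P (B `\` A)) <= V ((y \o k) \_ (B `\` A)).
  apply: IH => // w [/Bk[kK ?] nA]; split=> //.
  by move: kK; rewrite ltnS leq_eqVlt => /predU1P[/nA|].
rewrite -(setUIDK B A) !(addf_setU addV)// measureU// fineD ?fin_num_measure// mulrDr.
by rewrite addrACA lerD.
Qed.

Lemma addf_cvg_increment (X Y : nat -> T -> R) (M : R) :
  (forall n, Linf (X n)) -> (forall n, Linf (Y n)) ->
  (forall n w, `|X n w| <= M) -> (forall n w, `|Y n w| <= M) ->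
  (forall w, cvgn (X ^~ w)) -> (forall w, Y n w - X n w @[n --> \oo] --> (0 : R)) ->
  V (Y n) - V (X n) @[n --> \oo] --> (0 : R).
Proof.
move=> LX LY XM YM cvgX YX; pose f w := limn (X ^~ w).
have Xf w : X n w @[n --> \oo] --> f w by exact: cvgX.
have Yf w : Y n w @[n --> \oo] --> f w.
  rewrite -[f w]add0r (_ : (fun n => Y n w) = (fun n => Y n w - X n w + X n w)).
    exact: cvgD.
  by apply/funext => n; rewrite subrK.
have Lf : Linf f.
  apply: (@measurable_Linf _ _ _ _ M) => [|w].
    by apply: (@measurable_fun_cvg _ _ _ setT X) => // n; exact: Linf_measurable.
  by apply: (cvgr_to_le (cvg_norm (Xf w))); exact: nearW.
rewrite -(subrr (V f)); apply: cvgB; apply: (addf_cvg addV) => //; do ?exact: aeW.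
- by exists M.
- by exists M.
Qed.

Definition rat_increasing w := {homo (fun q : rat => r (ratr q) w) : p q / p < q}.

Lemma G_rat_increasing : G [set w | rat_increasing w].
Proof.
apply: (sub_sigma_forall sG) => p; apply: (sub_sigma_forall sG) => q.
by apply: (sub_sigma_cond sG); exact: G_meas_lt.
Qed.

Lemma rat_increasing_dyad w M n i N m j : rat_increasing w ->
  dyad M n i <= dyad N m j :> R -> r (dyad M n i) w <= r (dyad N m j) w.
Proof. by move=> /le_mono r_mono; rewrite !dyad_ratr ler_rat r_mono. Qed.

Section leftmost_jump.
Variables (M : nat) (e : R).
Local Notation dyad := (@dyad R M).
Local Notation size := (grid_size M).

Definition jump n i : set T := [set w | e + r (dyad n i) w <= r (dyad n (i + 2)) w].

Definition oscillating : set T := [set w | forall n, exists i : 'I_(size n), jump n i w].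

Definition first_jump n w : nat := find (fun i => w \in jump n i) (iota 0 (size n)).

Lemma G_jump n i : G (jump n i).
Proof. by apply: (G_meas_le sG) => //; apply: (G_measD sG) => //; exact: G_meas_cst. Qed.

Lemma G_oscillating : G oscillating.
Proof.
apply: (sub_sigma_forall sG) => n; apply: (sub_sigma_exists sG) => i; exact: G_jump.
Qed.

Lemma G_first_jump n i : G [set w | first_jump n w = i].
Proof. exact: (sub_sigma_find sG) (G_jump n). Qed.

Lemma first_jump_le_size n w : (first_jump n w <= size n)%N.
Proof. by rewrite -[leqRHS](size_iota 0); exact: find_size. Qed.

Lemma first_jumpP n w : oscillating w ->
  (first_jump n w < size n)%N /\ jump n (first_jump n w) w.
Proof.
move=> /(_ n)[i iw]; have hasj : has (fun i => w \in jump n i) (iota 0 (size n)).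
  by apply/hasP; exists (i : nat); [rewrite mem_iota ltn_ord|rewrite mem_set].
have lt : (first_jump n w < size n)%N by move: hasj; rewrite has_find size_iota.
by split=> //; have := nth_find 0%N hasj; rewrite nth_iota// => /set_mem.
Qed.

Lemma first_jump_le n i w : (i < size n)%N -> jump n i w -> (first_jump n w <= i)%N.
Proof.
move=> iM iw; rewrite leqNgt; apply/negP => /(before_find 0%N).
by rewrite nth_iota// mem_set.
Qed.

(* A jump over a cell of level [n + 1] is a jump over the cell of level [n] around it. *)
Lemma first_jump_half n w : oscillating w -> rat_increasing w ->
  (first_jump n w <= (first_jump n.+1 w)./2)%N.
Proof.
move=> wosc winc; have [jM] := first_jumpP n.+1 wosc; set j := first_jump n.+1 w in jM *.
move=> jw; apply: first_jump_le; first by rewrite ltn_half_double -mul2n -mulnCA -expnS.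
apply: le_trans (rat_increasing_dyad winc (dyad_half_ge M n j)).
by apply: le_trans jw; rewrite lerD2l rat_increasing_dyad// dyad_half_le.
Qed.

Definition left_end n : T -> R := dyad n \o first_jump n.

Definition right_end n : T -> R := (fun i => dyad n (i + 2)) \o first_jump n.

Lemma right_endE n w : right_end n w = left_end n w + 2 / 2 ^+ n.
Proof. exact: dyadD. Qed.

Lemma left_end_norm_le n w : `|left_end n w| <= M%:R.
Proof. exact/dyad_norm_le/first_jump_le_size. Qed.

Lemma right_end_norm_le n w : `|right_end n w| <= M%:R + 2.
Proof.
rewrite right_endE (le_trans (ler_normD _ _))// lerD ?left_end_norm_le//.
rewrite ger0_norm ?divr_ge0 ?exprn_ge0// ler_pdivrMr ?exprn_gt0// ler_peMr//.
by rewrite exprn_ege1// ler1n.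
Qed.

Lemma Linf_left_end n : Linf (left_end n).
Proof.
apply: (Linf_repW sG); split; first exact: (G_meas_comp_nat sG _ (G_first_jump n)).
by exists M%:R => w; exact: left_end_norm_le.
Qed.

Lemma Linf_right_end n : Linf (right_end n).
Proof.
apply: (Linf_repW sG); split; first exact: (G_meas_comp_nat sG _ (G_first_jump n)).
by exists (M%:R + 2) => w; exact: right_end_norm_le.
Qed.

Lemma left_end_nd w : oscillating w -> rat_increasing w ->
  nondecreasing_seq (left_end ^~ w).
Proof.
move=> wosc winc; apply/nondecreasing_seqP => n.
by apply: le_trans (dyad_half_le M n _); rewrite dyad_le first_jump_half.
Qed.

(* The leftmost jumps converge, so [V] would jump at their limit. *)
Lemma oscillating_null : 0 < e -> P (oscillating `&` [set w | rat_increasing w]) = 0%E.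
Proof.
move=> e0; set B := _ `&` _.
have GB : G B by exact: (sub_sigmaI sG G_oscillating G_rat_increasing).
have mB := sub_sigma_measurable sG GB.
have gap n : e * fine (P B) <= V (right_end n \_ B) - V (left_end n \_ B).
  rewrite lerBrDl; apply: (@addf_gap e _ _ _ (size n)) (G_first_jump n) GB _ _ _.
  - exact: Linf_left_end.
  - exact: Linf_right_end.
  - by move=> w [/(first_jumpP n)].
have : V (right_end n \_ B) - V (left_end n \_ B) @[n --> \oo] --> (0 : R).
  apply: (@addf_cvg_increment _ _ (M%:R + 2)) => [n|n|n w|n w|w|w].
  - by apply: Linf_restrict => //; exact: Linf_left_end.
  - by apply: Linf_restrict => //; exact: Linf_right_end.
  - rewrite /patch; case: ifP => _; last by rewrite normr0 addr_ge0.
    by rewrite (le_trans (left_end_norm_le n w))// lerDl.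
  - by rewrite /patch; case: ifP => _; [exact: right_end_norm_le|rewrite normr0 addr_ge0].
  - rewrite /patch; case: (boolP (w \in B)) => [/set_mem[wosc winc]|_]; last first.
      exact: is_cvg_cst.
    apply: nondecreasing_is_cvgn; first exact: left_end_nd.
    exists M%:R => _ [n _ <-]; exact: le_trans (ler_norm _) (left_end_norm_le n w).
  - rewrite /patch; case: (w \in B); last by rewrite subrr; exact: cvg_cst.
    rewrite (_ : (fun n => _) = (fun n => 2 / 2 ^+ n)); first exact: cvg_div_exp2.
    by apply/funext => n; rewrite right_endE addrC addKr.
move=> /cvgr_to_ge/(_ (nearW _ gap)); rewrite pmulr_rle0// => PB.
apply/eqP; rewrite -[P B]fineK ?fin_num_measure// eqe eq_le PB /=.
exact: fine_ge0.
Qed.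

End leftmost_jump.
End oscillation.

Lemma exists_rat_around {R : realType} (x : R) : exists p q : rat, ratr p < x < ratr q.
Proof.
have [x1 x2] : x - 1 < x /\ x < x + 1 by rewrite gtrBl ltrDl.
have [p] := rat_in_itvoo x1; rewrite in_itv/= => /andP[_ px].
have [q] := rat_in_itvoo x2; rewrite in_itv/= => /andP[xq _].
by exists p, q; rewrite px.
Qed.

Section regularize.
Context {d : measure_display} {T : measurableType d} {R : realType}.
Variable r : R -> T -> R.

Definition regularizable : set T := [set w | [/\ rat_increasing r w, r 0 w = 0 &
  forall Mm : nat * nat, ~ oscillating r Mm.1 Mm.2.+1%:R^-1 w]].

Definition regularize (w : T) (x : R) : R :=
  if w \in regularizable then sup [set r (ratr q) w | q in [set q : rat | ratr q < x]]
  else x.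

Lemma regularize_out w : ~ regularizable w -> regularize w = id.
Proof. by move=> nw; apply/funext => x; rewrite /regularize memNset. Qed.

Section regularizable_point.
Variable w : T.
Hypothesis w_reg : regularizable w.

Let r_le p q : p <= q -> r (ratr p) w <= r (ratr q) w.
Proof. by case: w_reg => /le_mono-> . Qed.

Lemma density_le_regularize q x : ratr q < x -> r (ratr q) w <= regularize w x.
Proof.
move=> qx; rewrite /regularize mem_set//; apply: ub_le_sup; last by exists q.
have [_ [p /andP[_ xp]]] := exists_rat_around x.
exists (r (ratr p) w) => _ [q' /= q'x <-].
by apply: r_le; rewrite -(ler_rat R) ltW// (lt_trans q'x).
Qed.

Lemma regularize_le_density q x : x <= ratr q -> regularize w x <= r (ratr q) w.
Proof.
move=> xq; rewrite /regularize mem_set//; apply: ge_sup.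
  have [p [_ /andP[px _]]] := exists_rat_around x.
  by exists (r (ratr p) w), p.
move=> _ [p /= px <-]; apply: r_le; rewrite -(ler_rat R).
exact: le_trans (ltW px) xq.
Qed.

Lemma regularize_lt x y : x < y -> regularize w x < regularize w y.
Proof.
move=> xy; have [p] := rat_in_itvoo xy; rewrite in_itv/= => /andP[xp py].
have [q] := rat_in_itvoo py; rewrite in_itv/= => /andP[pq qy].
apply: (le_lt_trans (regularize_le_density (ltW xp))).
apply: (lt_le_trans _ (density_le_regularize qy)).
by case: w_reg => inc _ _; apply: inc; rewrite -(ltr_rat R).
Qed.

Lemma density_small_increment (x e : R) : 0 < e -> exists p q : rat,
  (ratr p < x < ratr q) /\ r (ratr q) w - r (ratr p) w < e.
Proof.
move=> e0; have [m me] : exists m : nat, m.+1%:R^-1 < e.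
  near \oo => m; exists m; near: m; exact: (near_infty_natSinv_lt (PosNum e0)).
pose M := (Num.truncn `|x|).+2.
have /andP[Mx xM] : - M%:R + 1 < x < M%:R - 1.
  have /andP[_] := truncn_itv (normr_ge0 x); rewrite ltr_norml /M -[in X in _ -> X]natr1.
  by move=> /andP[? ?]; apply/andP; lra.
have [_ _ /(_ (M, m))] := w_reg; move=> /existsNP[n no_jump].
have [|i iM /andP[ix xi]] := @dyad_bracket R M n x; first by apply/andP; lra.
exists (i%:R / 2 ^+ n - M%:R), ((i + 2)%:R / 2 ^+ n - M%:R).
rewrite -!dyad_ratr ix xi; split=> //; apply: lt_trans me.
by rewrite ltrBlDr ltNge; apply/negP => jump_i; apply: no_jump; exists (Ordinal iM).
Unshelve. all: by end_near. Qed.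

Lemma regularize_continuous : continuous (regularize w).
Proof.
move=> x; apply/cvgrPdist_lt => e e0.
have [p [q [/andP[px xq] pqe]]] := density_small_increment x e0.
near=> y.
have py : ratr p < y by near: y; exact: (cvgr_gt x cvg_id).
have yq : y < ratr q by near: y; exact: (cvgr_lt x cvg_id).
have := density_le_regularize px; have := regularize_le_density (ltW xq).
have := density_le_regularize py; have := regularize_le_density (ltW yq).
by rewrite ltr_norml => *; apply/andP; lra.
Unshelve. all: by end_near. Qed.

Lemma regularize_rat q : regularize w (ratr q) = r (ratr q) w.
Proof.
apply/eqP; rewrite eq_le regularize_le_density//=.
have right_cvg : regularize w y @[y --> (ratr q)^'+] --> regularize w (ratr q).
  exact/cvg_at_right_filter/regularize_continuous.
by apply: (cvgr_to_ge right_cvg); near=> y; apply: density_le_regularize.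
Unshelve. all: by end_near. Qed.

End regularizable_point.
End regularize.

Section regular_version.
Context {d : measure_display} {T : measurableType d} {R : realType}.
Variable P : probability T R.
Variable V : (T -> R) -> R.
Hypothesis addV : additive_functional P V.
Hypothesis V_lt : forall x y A, x < y -> measurable A -> (0 < P A)%E ->
  V (cst x \_ A) < V (cst y \_ A).
Variable G : set (set T).
Hypothesis sG : sub_sigma G.
Variable r : R -> T -> R.
Hypothesis r_density : forall x, [/\ G_meas G (r x), P.-integrable setT (EFin \o r x) &
   forall A, G A -> \int[P]_(w in A) r x w = V (cst x \_ A)].

Let r_meas x : G_meas G (r x). Proof. by case: (r_density x). Qed.
Let r_integrable x : P.-integrable setT (EFin \o r x). Proof. by case: (r_density x). Qed.
Let r_integral x A : G A -> \int[P]_(w in A) r x w = V (cst x \_ A).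
Proof. by case: (r_density x) => _ _; exact. Qed.

Lemma rat_increasing_ae : {ae P, forall w, rat_increasing r w}.
Proof.
apply: ae_forall_count => p; apply: ae_forall_count => q.
have [pq|qp] := boolP (p < q); last exact: aeW.
suff : {ae P, forall w, r (ratr p) w < r (ratr q) w} by apply: filterS.
apply: (ae_lt_Rintegral sG) => // A GA A0; rewrite !r_integral//.
by apply: V_lt; rewrite ?ltr_rat//; exact: sub_sigma_measurable GA.
Qed.

Lemma density0_ae : {ae P, forall w, r 0 w = 0}.
Proof.
apply: (ae_eq_condexp sG) => // [||A GA]; [exact: G_meas_cst|exact: integrable0|].
rewrite r_integral// restrictE patch_id (addf0 addV) Rintegral_cst ?mul0r//.
exact: sub_sigma_measurable GA.
Qed.

Lemma G_regularizable : G (regularizable r).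
Proof.
pose Osc (Mm : nat * nat) : set T := oscillating r Mm.1 Mm.2.+1%:R^-1.
rewrite (_ : regularizable r = [set w | rat_increasing r w] `&`
    ([set w | r 0 w = 0] `&` [set w | forall Mm, (~` Osc Mm) w])).
  apply: (sub_sigmaI sG); first exact: (G_rat_increasing sG r_density).
  apply: (sub_sigmaI sG); first exact: G_meas_fiber.
  apply: (sub_sigma_forall sG) => Mm; apply: (sub_sigmaC sG).
  exact: (G_oscillating sG r_density).
by apply/seteqP; split=> w [? []]; split.
Qed.

Lemma regularizable_ae : {ae P, forall w, regularizable r w}.
Proof.
have steady : {ae P, forall w, forall Mm : nat * nat,
    ~ (oscillating r Mm.1 Mm.2.+1%:R^-1 `&` [set w | rat_increasing r w]) w}.
  apply: ae_forall_count => -[M m]; apply: null_set_ae.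
    apply: (sub_sigma_measurable sG); apply: (sub_sigmaI sG).
      exact: (G_oscillating sG r_density).
    exact: (G_rat_increasing sG r_density).
  exact: (oscillating_null addV sG r_density).
apply: filterS3 rat_increasing_ae density0_ae steady => w inc r0 st; split=> // Mm osc.
by apply: (st Mm).
Qed.

Lemma regular_regularize : regular G (regularize r).
Proof.
have mono w x y : x < y -> regularize r w x < regularize r w y.
  have [w_reg|/regularize_out->//] := pselect (regularizable r w).
  exact: regularize_lt.
have cont w : continuous (regularize r w).
  have [w_reg|/regularize_out->] := pselect (regularizable r w).
    exact: regularize_continuous.
  by move=> x; exact: cvg_id.
have rat_glue q : (fun w => regularize r w (ratr q)) =
    patch (cst (ratr q)) (regularizable r) (r (ratr q)).
  apply/funext => w; have [w_reg|nw] := pselect (regularizable r w).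
    by rewrite patch_in// regularize_rat.
  by rewrite patch_out// regularize_out.
split=> // [w|].
  have [w_reg|/regularize_out->//] := pselect (regularizable r w).
  by have := regularize_rat w_reg 0; rewrite rmorph0 => ->; case: w_reg.
apply: (prod_sigma_measurable sG) => // q; rewrite rat_glue.
by apply: G_meas_patch => //; [exact: G_regularizable|exact: G_meas_cst].
Qed.

Let regularize_measurable x : measurable_fun setT (fun w => regularize r w x).
Proof.
apply: (G_meas_measurable sG).
exact: (regular_G_meas sG regular_regularize (G_meas_cst sG x)).
Qed.

Lemma regularize_rat_ae q : aeeq P (fun w => regularize r w (ratr q)) (r (ratr q)).
Proof. by apply: filterS regularizable_ae => w w_reg; exact: regularize_rat. Qed.

Lemma regularize_rat_integrable q :
  P.-integrable setT (fun w => (regularize r w (ratr q))%:E).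
Proof.
apply/integrableP; split; first exact/measurable_EFinP.
have /integrableP[mr] := r_integrable (ratr q); apply: le_lt_trans.
rewrite le_eqVlt; apply/predU1P; left.
apply: ae_eq_integral => //; [|exact: measurableT_comp|].
  exact/measurableT_comp/measurable_EFinP.
by apply: filterS (regularize_rat_ae q) => w -> _.
Qed.

Lemma regularize_integrable x : P.-integrable setT (fun w => (regularize r w x)%:E).
Proof.
have [p [q /andP[px xq]]] := exists_rat_around x.
have := integrableD measurableT (integrable_abse (regularize_rat_integrable p))
  (integrable_abse (regularize_rat_integrable q)).
apply: le_integrable => //; first exact/measurable_EFinP.
move=> w _; rewrite /= lee_fin [leRHS]ger0_norm ?addr_ge0//.
by apply: (regular_norm_le regular_regularize); rewrite !ltW.
Qed.

Lemma expected_utility_regularize f : Linf_rep G f ->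
  V f = expected_utility P (regularize r) f.
Proof.
have rF := regularW sG regular_regularize.
apply: (addf_eq addV (expected_utility_additive rF regularize_integrable) sG) => q A GA.
have mA := sub_sigma_measurable sG GA.
rewrite (expected_utility_restrict P rF)// -r_integral//; apply/esym.
apply: ae_eq_Rintegral => //; last exact: regularize_rat_ae.
  exact: (regular_measurable rF (Linf_cst _)).
by apply: measurable_funTS; exact: (G_meas_measurable sG).
Qed.

End regular_version.

Lemma exists_regular_representation {d : measure_display} {T : measurableType d}
    {R : realType} (P : probability T R) (V : (T -> R) -> R) (G : set (set T)) :
  additive_functional P V ->
  (forall x y A, x < y -> measurable A -> (0 < P A)%E -> V (cst x \_ A) < V (cst y \_ A)) ->
  sub_sigma G ->
  exists u : T -> R -> R, [/\ regular G u,
    forall x, P.-integrable setT (fun w => (u w x)%:E) &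
    forall f, Linf_rep G f -> V f = expected_utility P u f].
Proof.
move=> addV V_lt sG; have [r r_density] := choice (exists_addf_density addV sG).
exists (regularize r); split.
- exact: (regular_regularize sG r_density).
- exact: (regularize_integrable addV V_lt sG r_density).
- exact: (expected_utility_regularize addV V_lt sG r_density).
Qed.

(** * Nonlinear expectations *)

Section utility_functional.
Context {d : measure_display} {T : measurableType d} {R : realType}.
Variable P : probability T R.
Variable E : set (set T) -> (T -> R) -> (T -> R).
Implicit Types (G : set (set T)) (A : set T) (f g X Y Z : T -> R).

Definition represents (u : T -> R -> R) G (uG : T -> R -> R) : Prop :=
  [/\ regular G uG,
      forall x, P.-integrable setT (fun w => (uG w x)%:E) /\
                condexp_version P G (fun w => u w x) (fun w => uG w x) &
      forall f, Linf f ->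
        (exists h, condexp_version P G (fun w => u w (f w)) h /\
                   forall w, exists y, h w = uG w y) /\
        (forall h, condexp_version P G (fun w => u w (f w)) h ->
                   (forall w, exists y, h w = uG w y) ->
                   aeeq P (E G f) (fun w => Phi uG w (h w)))].

Definition utility_representation (u : T -> R -> R) : Prop :=
  [/\ regular Fsig u, forall x, P.-integrable setT (fun w => (u w x)%:E) &
      forall G, sub_sigma G -> exists uG, represents u G uG].

(* [E G f] is the conditional certainty equivalent of [f] under [V]. *)
Record utility_functional (V : (T -> R) -> R) : Prop := UtilityFunctional {
  utilf_additive : additive_functional P V;
  utilf_lt : forall x y A, x < y -> measurable A -> (0 < P A)%E ->
    V (cst x \_ A) < V (cst y \_ A);
  utilf_cond : forall G f A, sub_sigma G -> Linf f -> G A ->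
    V (E G f \_ A) = V (f \_ A) }.

End utility_functional.

Lemma homo_lt_cvg {R : realType} (psi : R -> R) (x : nat -> R) l :
  {homo psi : y z / y < z} ->
  psi (x n) @[n --> \oo] --> psi l -> x n @[n --> \oo] --> l.
Proof.
move=> psi_lt psi_cvg; have psi_ltE := leW_mono (le_mono psi_lt).
apply/cvgrPdist_lt => e e0; near=> n.
have lx : l - e < x n.
  by rewrite -psi_ltE; near: n; apply: (cvgr_gt _ psi_cvg); rewrite psi_ltE gtrBl.
have xl : x n < l + e.
  by rewrite -psi_ltE; near: n; apply: (cvgr_lt _ psi_cvg); rewrite psi_ltE ltrDl.
by rewrite ltr_distlC lx xl.
Unshelve. all: by end_near. Qed.

Section family.
Context {d : measure_display} {T : measurableType d} {R : realType}.
Variable P : probability T R.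
Variable E : set (set T) -> (T -> R) -> (T -> R).
Hypothesis famE : Linf_family P E.
Implicit Types (G : set (set T)) (A : set T) (f g X Y Z : T -> R).

Lemma family_Linf_rep G f : sub_sigma G -> Linf f -> Linf_rep G (E G f).
Proof. by move=> /famE[+ _]; apply. Qed.

Lemma family_Linf G f : sub_sigma G -> Linf f -> Linf (E G f).
Proof. by move=> sG Lf; apply: (Linf_repW sG); exact: family_Linf_rep. Qed.

Lemma family_ae G f g : sub_sigma G -> Linf f -> Linf g -> aeeq P f g ->
  aeeq P (E G f) (E G g).
Proof. by move=> /famE[_]; apply. Qed.

Lemma family_triv f w : Linf f -> E trivsig f = cst (E trivsig f w).
Proof.
move=> Lf; apply/funext => w'; apply: trivsig_cst.
by case: (family_Linf_rep sub_sigma_triv Lf).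
Qed.

End family.

(* Functions measurable for this sigma-algebra are constant on [A]; conditioning on it
   turns locality and time consistency into the sure-thing principle on [A]. *)
Section atom_sigma.
Context {d : measure_display} {T : measurableType d} {R : realType}.
Variable A : set T.
Hypothesis mA : measurable A.

Definition atom_sigma : set (set T) :=
  [set B | measurable B /\ (A `<=` B \/ A `&` B = set0)].

Lemma sub_sigma_atom : sub_sigma atom_sigma.
Proof.
split; last by move=> B [].
split=> [|B [mB AB]|F F_atom].
- by split; [exact: measurable0|right; rewrite setI0].
- rewrite setTD; split; first exact: measurableC.
  case: AB => [/subsetC/disjoints_subset|/disjoints_subset]; last by left.
  by right; rewrite setIC.
- split; first by apply: bigcupT_measurable => n; case: (F_atom n).
  have [[n AF]|/forallNP nA] := pselect (exists n, A `<=` F n).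
    by left; exact: subset_trans AF (bigcup_sup _).
  by right; rewrite setI_bigcupr bigcup0// => n _; case: (F_atom n) => _ [/nA|].
Qed.

Lemma atom_sigma_atom : atom_sigma A. Proof. by split=> //; left. Qed.

Lemma atom_sigma_cst (h : T -> R) w w' :
  G_meas atom_sigma h -> A w -> A w' -> h w = h w'.
Proof.
move=> /(_ [set h w] (measurable_set1 _))[_ [AB|AB]] Aw Aw'.
  by have /= -> := AB _ Aw'.
by have : (A `&` (h @^-1` [set h w])) w by []; rewrite AB.
Qed.

End atom_sigma.

Section necessity.
Context {d : measure_display} {T : measurableType d} {R : realType}.
Variable P : probability T R.
Variable E : set (set T) -> (T -> R) -> (T -> R).
Hypothesis famE : Linf_family P E.
Hypothesis E_local : cond_nonlin_exp P E.
Hypothesis E_tc : time_consistent E.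
Hypothesis E_lt : strict_mono_dichotomic P E.
Hypothesis E_cvg : pointwise_continuous P E.
Implicit Types (G : set (set T)) (A : set T) (f g X Y Z : T -> R).

Let I f : R := E trivsig f point.

Let I_ae f g : Linf f -> Linf g -> aeeq P f g -> I f = I g.
Proof.
move=> Lf Lg fg; have [w] := ae_exists (family_ae famE sub_sigma_triv Lf Lg fg).
by rewrite /I (family_triv famE w Lf) (family_triv famE w Lg).
Qed.

Let I_lt x y Z A : x < y -> Linf Z -> measurable A -> (0 < P A)%E ->
  I (patch Z A (cst x)) < I (patch Z A (cst y)).
Proof. by move=> xy LZ mA A0; rewrite -!indic_patch; exact: E_lt. Qed.

Let I_family G f : sub_sigma G -> Linf f -> I (E G f) = I f.
Proof. by move=> sG Lf; exact: E_tc. Qed.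

Let I_cst c : I (cst c) = c.
Proof.
have I_cst_lt : {homo (fun x => I (cst x)) : x y / x < y}.
  move=> x y xy; rewrite -(patch_setT (cst 0) (cst x)) -(patch_setT (cst 0) (cst y)).
  by apply: I_lt => //; rewrite probability_setT lte01.
apply: (inc_inj (le_mono I_cst_lt)).
by rewrite -[RHS](I_family sub_sigma_triv)// [in RHS](family_triv famE point).
Qed.

Let E_restrict G f A : sub_sigma G -> Linf f -> G A ->
  aeeq P (E G (f \_ A)) (E G f \_ A).
Proof. by move=> sG Lf GA; rewrite -!indic_restrict; exact: E_local. Qed.

Let I_patch_atom A X Z wA : measurable A -> A wA -> Linf X -> Linf Z ->
  I (patch Z A X) = I (patch (E (atom_sigma A) (Z \_ (~` A))) A
                             (cst (E (atom_sigma A) (X \_ A) wA))).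
Proof.
move=> mA AwA LX LZ; have sG := sub_sigma_atom A; have GA := atom_sigma_atom mA.
have mAC : measurable (~` A) by exact: measurableC.
have LXZ : Linf (patch Z A X) by exact: Linf_patch.
have LXA : Linf (X \_ A) by exact: Linf_restrict.
have LZA : Linf (Z \_ (~` A)) by exact: Linf_restrict.
rewrite -(I_family sG)//; apply: I_ae.
- exact: (family_Linf famE).
- by apply: Linf_patch => //; exact: (family_Linf famE).
have onA := E_restrict sG LXZ GA; have offA := E_restrict sG LXZ (sub_sigmaC sG GA).
have XZA : patch Z A X \_ A = X \_ A by apply: eq_patch => // w Aw; rewrite patch_in.
have XZAC : patch Z A X \_ (~` A) = Z \_ (~` A).
  by apply: eq_patch => // w nA; rewrite patch_out.
rewrite XZA in onA; rewrite XZAC in offA.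
apply: filterS2 onA offA => w onA offA; have [Aw|nAw] := pselect (A w).
  rewrite patch_in// in onA; rewrite [RHS]patch_in//= -onA.
  by apply: atom_sigma_cst Aw AwA; case: (family_Linf_rep famE sG LXA).
by rewrite patch_in// in offA; rewrite [RHS]patch_out// offA.
Qed.

Let I_sure_thing A X X' Z Z' : measurable A -> Linf X -> Linf X' -> Linf Z -> Linf Z' ->
  I (patch Z A X) <= I (patch Z A X') -> I (patch Z' A X) <= I (patch Z' A X').
Proof.
move=> mA LX LX' LZ LZ'; have [A0|A0] := eqVneq (P A) 0%E.
  move=> _; rewrite (@I_ae _ (patch Z' A X'))//; do ?exact: Linf_patch.
  by have := null_set_ae mA A0; apply: filterS => w nAw; rewrite !patch_out.
have [wA AwA] : A !=set0.
  by apply: contrapT => /nonemptyPn Ae; move: A0; rewrite Ae measure0 eqxx.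
rewrite -measure_gt0 in A0.
have Lrest Y : Linf Y -> Linf (E (atom_sigma A) (Y \_ (~` A))).
  move=> LY; apply: (family_Linf famE); first exact: sub_sigma_atom.
  by apply: Linf_restrict => //; exact: measurableC.
rewrite (I_patch_atom mA AwA LX LZ) (I_patch_atom mA AwA LX' LZ).
rewrite (I_patch_atom mA AwA LX LZ') (I_patch_atom mA AwA LX' LZ').
set x := E _ (X \_ A) wA; set x' := E _ (X' \_ A) wA => Ixx'.
have [x'x|] := ltP x' x.
  by have := I_lt x'x (Lrest _ LZ) mA A0; rewrite ltNge Ixx'.
rewrite le_eqVlt => /predU1P[->//|xx'].
by apply/ltW/I_lt => //; exact: Lrest.
Qed.

Lemma preference_nonlin_exp : preference P I.
Proof.
split=> [X Y|X f LX Lf bX Xf|x y Z A|c|A X X' Z Z'].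
- exact: I_ae.
- exact: E_cvg.
- exact: I_lt.
- exact: I_cst.
- exact: I_sure_thing.
Qed.

Lemma exists_utility_functional : nonatomic P -> exists V, utility_functional P E V.
Proof.
move=> naP.
have [phi phi_lt addV] := exists_additive_functional naP preference_nonlin_exp.
exists (phi \o I); split=> // [x y A xy mA A0|G f A sG Lf GA].
  by apply: phi_lt; exact: (I_lt xy (Linf_cst 0) mA A0).
have LfA : Linf (f \_ A) by apply: Linf_restrict => //; exact: sub_sigma_measurable GA.
rewrite /= -(I_family sG LfA); congr phi; apply/esym/I_ae.
- exact: (family_Linf famE).
- apply: Linf_restrict; first exact: sub_sigma_measurable GA.
  exact: (family_Linf famE).
- exact: E_restrict.
Qed.

End necessity.

Section representation.
Context {d : measure_display} {T : measurableType d} {R : realType}.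
Variable P : probability T R.
Variable E : set (set T) -> (T -> R) -> (T -> R).
Hypothesis famE : Linf_family P E.
Implicit Types (G : set (set T)) (A : set T) (f g X Y Z : T -> R).

Section of_utility_functional.
Variable V : (T -> R) -> R.
Hypothesis utilV : utility_functional P E V.

Lemma utility_functional_representation : exists u, utility_representation P E u.
Proof.
have [addV V_lt V_cond] := utilV.
have [u [ru iu Vu]] := exists_regular_representation addV V_lt sub_sigmaF.
exists u; split=> // G sG.
have [v [rv iv Vv]] := exists_regular_representation addV V_lt sG.
have rvF := regularW sG rv.
have condexp f g : Linf f -> Linf_rep G g ->
    (forall A, G A -> V (g \_ A) = V (f \_ A)) ->
    condexp_version P G (fun w => u w (f w)) (fun w => v w (g w)).
  move=> Lf Gg Vgf; have Lg := Linf_repW sG Gg; split.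
  - by apply: (regular_G_meas sG rv); case: Gg.
  - exact: (regular_integrable rvF iv Lg measurableT).
  move=> A GA; have mA := sub_sigma_measurable sG GA.
  apply: Rintegral_EFin => //; [exact: regular_integrable..|].
  rewrite -(expected_utility_restrict P rvF)// -(expected_utility_restrict P ru)//.
  by rewrite -Vv ?Vgf// ?Vu//; [exact: Linf_restrict|exact: Linf_rep_restrict].
exists v; split=> // [x|f Lf].
  by split=> //; apply: (condexp (cst x) (cst x)) => //; exact: Linf_rep_cst.
have cond_f : condexp_version P G (fun w => u w (f w)) (fun w => v w (E G f w)).
  by apply: condexp => // [|A GA]; [exact: (family_Linf_rep famE)|exact: V_cond].
split; first by exists (fun w => v w (E G f w)); split=> // w; exists (E G f w).
move=> h [mh ih hE] _; have [mk ik kE] := cond_f.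
have : aeeq P h (fun w => v w (E G f w)).
  by apply: (ae_eq_condexp sG) => // A GA; rewrite /Rintegral hE// kE.
by apply: filterS => w ->; rewrite (Phi_regular rv).
Qed.

Let V_cst_lt : {homo (fun x => V (cst x)) : x y / x < y}.
Proof.
move=> x y xy; rewrite -(patch_setT (cst 0) (cst x)) -(patch_setT (cst 0) (cst y)).
by apply: (utilf_lt utilV) => //; rewrite probability_setT lte01.
Qed.

Let V_triv f w : Linf f -> V (cst (E trivsig f w)) = V f.
Proof.
move=> Lf; rewrite -(family_triv famE)// -(patch_setT (cst 0) (E _ _)).
rewrite -[f in RHS](patch_setT (cst 0)).
exact: (utilf_cond utilV sub_sigma_triv Lf (sub_sigmaT sub_sigma_triv)).
Qed.

Lemma utility_functional_ae G f g : sub_sigma G -> Linf_rep G f -> Linf_rep G g ->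
  (forall A, G A -> V (f \_ A) = V (g \_ A)) -> aeeq P f g.
Proof.
move=> sG Gf Gg Vfg; have [addV V_lt _] := utilV.
have [v [rv iv Vv]] := exists_regular_representation addV V_lt sG.
have rvF := regularW sG rv.
suff : aeeq P (fun w => v w (f w)) (fun w => v w (g w)).
  by apply: filterS => w; exact: regular_inj rv _ _ _.
apply: (ae_eq_condexp sG).
- by apply: (regular_G_meas sG rv); case: Gf.
- by apply: (regular_G_meas sG rv); case: Gg.
- exact: (regular_integrable rvF iv (Linf_repW sG Gf)).
- exact: (regular_integrable rvF iv (Linf_repW sG Gg)).
move=> A GA; have mA := sub_sigma_measurable sG GA.
by rewrite -!(expected_utility_restrict P rvF)// -!Vv ?Vfg//; exact: Linf_rep_restrict.
Qed.

Lemma utility_functional_local : cond_nonlin_exp P E.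
Proof.
move=> G sG f Lf A GA; rewrite !indic_restrict.
have [mA GEf] := (sub_sigma_measurable sG GA, family_Linf_rep famE sG Lf).
have LfA : Linf (f \_ A) by exact: Linf_restrict.
apply: (utility_functional_ae sG) => [||B GB].
- exact: (family_Linf_rep famE).
- exact: Linf_rep_restrict.
rewrite (utilf_cond utilV)// -!patch_setI (utilf_cond utilV)//.
exact: sub_sigmaI.
Qed.

Lemma utility_functional_consistent : time_consistent E.
Proof.
move=> G sG f Lf w; have LE := family_Linf famE sG Lf.
apply: (inc_inj (le_mono V_cst_lt)); rewrite !V_triv//.
rewrite -(patch_setT (cst 0) (E G f)) -[f in RHS](patch_setT (cst 0)).
exact: (utilf_cond utilV sG Lf (sub_sigmaT sG)).
Qed.

Lemma utility_functional_strict_mono : strict_mono_dichotomic P E.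
Proof.
move=> x y Z A xy LZ mA A0 w.
have mAC : measurable (~` A) by exact: measurableC.
have V_patch c : V (patch Z A (cst c)) = V (cst c \_ A) + V (Z \_ (~` A)).
  rewrite (addf_restrict (utilf_additive utilV) mA); last exact: Linf_patch.
  congr (V _ + V _).
    by apply: eq_patch => // v Av; rewrite patch_in.
  by apply: eq_patch => // v nAv; rewrite patch_out.
rewrite !(indic_patch A (cst _)) -(leW_mono (le_mono V_cst_lt)).
rewrite !V_triv; do ?exact: Linf_patch.
by rewrite !V_patch ltrD2r; exact: (utilf_lt utilV).
Qed.

Lemma utility_functional_continuous : pointwise_continuous P E.
Proof.
move=> X f LX Lf bX Xf w; apply: (homo_lt_cvg V_cst_lt); rewrite V_triv//.
under eq_fun do rewrite V_triv//.
exact: (addf_cvg (utilf_additive utilV) LX Lf bX Xf).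
Qed.

End of_utility_functional.

Lemma representation_utility_functional u : utility_representation P E u ->
  utility_functional P E (expected_utility P u).
Proof.
move=> [ru iu repE]; have addJ := expected_utility_additive ru iu.
split=> // [x y A xy mA A0|G f A sG Lf GA].
  rewrite !(expected_utility_restrict P ru)//.
  apply: lt_Rintegral => // [||w _]; [exact: integrableS (iu _)..|].
  exact: (regular_lt ru).
have [v [rv iv fv]] := repE G sG; have rvF := regularW sG rv.
have iv' x : P.-integrable setT (fun w => (v w x)%:E) by case: (iv x).
have [mA LE] := (sub_sigma_measurable sG GA, family_Linf famE sG Lf).
have Jv : forall g, Linf_rep G g -> expected_utility P u g = expected_utility P v g.
  apply: (addf_eq addJ (expected_utility_additive rvF iv') sG) => q B GB.
  have mB := sub_sigma_measurable sG GB; rewrite !expected_utility_restrict//.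
  by have [_ [_ _ vB]] := iv (ratr q); rewrite /Rintegral/= vB.
rewrite Jv; last by apply: (Linf_rep_restrict sG) => //; exact: (family_Linf_rep famE).
rewrite !expected_utility_restrict//.
have [[h [[mh ih hE] hv]] /(_ h _ hv) Eh] := fv f Lf.
transitivity (\int[P]_(w in A) h w); last by rewrite /Rintegral hE.
apply: ae_eq_Rintegral => //; first exact: regular_measurable.
  by apply: measurable_funTS; exact: G_meas_measurable mh.
by apply: filterS (Eh _) => // w ->; have [y ->] := hv w; rewrite (Phi_regular rv).
Qed.

End representation.

Unset Implicit Arguments.

Theorem mainTheorem1 (d : measure_display) (T : measurableType d)
    (R : realType) (P : probability T R)
    (E : set (set T) -> (T -> R) -> (T -> R)) :
  nonatomic P -> Linf_family P E ->
  ([/\ cond_nonlin_exp P E, time_consistent E,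
       strict_mono_dichotomic P E & pointwise_continuous P E]
   <->
   exists u : T -> R -> R,
     [/\ regular Fsig u,
         forall x, P.-integrable setT (fun w => (u w x)%:E) &
         forall G, sub_sigma G ->
           exists uG : T -> R -> R,
             [/\ regular G uG,
                 forall x, P.-integrable setT (fun w => (uG w x)%:E) /\
                           condexp_version P G (fun w => u w x) (fun w => uG w x) &
                 forall f, Linf_rep Fsig f ->
                   (exists h, condexp_version P G (fun w => u w (f w)) h /\
                              forall w, exists y, h w = uG w y) /\
                   (forall h, condexp_version P G (fun w => u w (f w)) h ->
                              (forall w, exists y, h w = uG w y) ->
                              aeeq P (E G f) (fun w => Phi uG w (h w)))]]).
Proof.
move=> naP famE; split=> [[E_local E_tc E_lt E_cvg]|[u repE]].
  have [V utilV] := exists_utility_functional famE E_local E_tc E_lt E_cvg naP.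
  exact: (utility_functional_representation famE utilV).
have utilJ := representation_utility_functional famE repE.
split.
- exact: (utility_functional_local famE utilJ).
- exact: (utility_functional_consistent famE utilJ).
- exact: (utility_functional_strict_mono famE utilJ).
- exact: (utility_functional_continuous famE utilJ).
Qed.
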